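(* Let $m,r,b>0$, $0<D_0\le D_1$, $T<\infty$, and let $W$ be a standard Brownian motion. For $\epsilon>0$ let $(q^\epsilon,\sigma^\epsilon)$ be defined on $[0,T]$ by $q^\epsilon(0)=0$, $\sigma^\epsilon(0)=0$, $$dq^\epsilon(t)=\begin{cases} m\,dt+D_0\,dW_t & \text{if } \sigma^\epsilon(t)=0,\\ -\tfrac{r}{\epsilon}\,dt+D_1\,dW_t & \text{if } \sigma^\epsilon(t)=r/\epsilon,\end{cases}$$ where $\sigma^\epsilon$ takes values in $\{0,r/\epsilon\}$, switches from $0$ to $r/\epsilon$ when $q^\epsilon$ hits $b$ and back to $0$ when $q^\epsilon$ next hits $0$, repeatedly (extend $\sigma^\epsilon$ by $0$ for $t>T$). Let $E_t$ solve $dE_t=m\,dt+D_0\,dW_t$, $E_0=0$ (same $W$), let $\tau_k^d=\inf\{t>0: E(t)=kb\}$ for $k\in\mathbb{N}$, let $\mathcal{N}(T)$ be the number of $k$ with $\tau_k^d\le T$, and define the point process $$\sigma(t)=b\sum_{i=1}^{\mathcal{N}(T)}\delta(t-\tau_i^d).$$ Then for every test function $\phi\in C_c^\infty(0,\infty)$, $$\lim_{\epsilon\to0}\mathbb{E}\left[\left|\langle\sigma^\epsilon,\phi\rangle-\langle\sigma,\phi\rangle\right|^2\right]=0,\qquad\text{where }\langle f,g\rangle=\int_0^\infty f(t)g(t)\,dt$$ (so $\langle\sigma,\phi\rangle=b\sum_{i=1}^{\mathcal{N}(T)}\phi(\tau_i^d)$). *)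

(* Defs.v *)
From HB Require Import structures.
From mathcomp Require Import all_boot all_order all_algebra.
From mathcomp Require Import finmap all_classical all_reals all_analysis.
Set Implicit Arguments. Unset Strict Implicit. Unset Printing Implicit Defensive.
Import Order.TTheory GRing.Theory Num.Theory.
Import numFieldNormedType.Exports.
Local Open Scope classical_set_scope.
Local Open Scope ring_scope.

Definition standard_BM {R : realType} (d : measure_display)
  (Omega : measurableType d) (P : probability Omega R)
  (W : R -> Omega -> R) : Prop :=
  [/\ (forall w, W 0 w = 0),
      (forall w, {within `[0, +oo[, continuous (fun t => W t w)}),
      (forall t, measurable_fun setT (W t)) &
      (forall (n : nat) (t : nat -> R) (B : nat -> set R),
          0 <= t 0%N ->
          (forall i, (i < n)%N -> t i < t i.+1) ->
          (forall i, (i < n)%N -> measurable (B i)) ->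
          P (\bigcap_(i in [set i | (i < n)%N])
               [set w | W (t i.+1) w - W (t i) w \in B i])
          = \big[*%E/1%E]_(i < n)
              normal_prob 0 (Num.sqrt (t i.+1 - t i)) (B i))].

(* Pathwise description of the switched system (q, sigma) driven by a path w
   on [0,T], with switching times s_0 = 0 < s_1 < s_2 < ... :
   on [s_(2j), s_(2j+1)) : sigma = 0,     q t = m (t - s) + D0 (w t - w s)
                           (q restarts from 0, s = s_(2j)), and q < b there;
     s_(2j+1) is the hitting time of b (if it is <= T);
   on [s_(2j+1), s_(2j+2)) : sigma = r/eps,
                           q t = b - (r/eps)(t - s) + D1 (w t - w s)
                           (s = s_(2j+1)), and q > 0 there;
     s_(2j+2) is the hitting time of 0 (if it is <= T);
   the switching times eventually exceed T; sigma = 0 for t > T.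
   This is the (pathwise, additive-noise) solution of the SDE in the paper. *)
Definition switched_solution {R : realType} (m r b D0 D1 eps T : R)
  (w q sig : R -> R) : Prop :=
  exists s : nat -> R,
    s 0%N = 0 /\
      (forall k, s k <= T -> s k < s k.+1) /\
      (exists k, T < s k) /\
      (forall j t, s j.*2 <= t -> t < s j.*2.+1 -> t <= T ->
          [/\ sig t = 0,
              q t = m * (t - s j.*2) + D0 * (w t - w (s j.*2)) &
              q t < b]) /\
      (forall j, s j.*2.+1 <= T ->
          m * (s j.*2.+1 - s j.*2) + D0 * (w (s j.*2.+1) - w (s j.*2)) = b) /\
      (forall j t, s j.*2.+1 <= t -> t < s j.*2.+2 -> t <= T ->
          [/\ sig t = r / eps,
              q t = b - r / eps * (t - s j.*2.+1)
                      + D1 * (w t - w (s j.*2.+1)) &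
              0 < q t]) /\
      (forall j, s j.*2.+2 <= T ->
          b - r / eps * (s j.*2.+2 - s j.*2.+1)
            + D1 * (w (s j.*2.+2) - w (s j.*2.+1)) = 0) /\
      (forall t, T < t -> sig t = 0).

Definition pairing {R : realType} (f g : R -> R) : R :=
  Rintegral lebesgue_measure `[0, +oo[ (fun t => f t * g t).

(* tau_k = inf {t > 0 : E t = k b}  (in \bar R, = +oo if the set is empty) *)
Definition hitting_time {R : realType} (E : R -> R) (b : R) (k : nat) : \bar R :=
  ereal_inf [set t%:E | t in [set t | 0 < t /\ E t = k%:R * b]].

Definition num_hits {R : realType} (E : R -> R) (b T : R) : nat :=
  (#|` fset_set [set k : nat | (0 < k)%N /\ (hitting_time E b k <= T%:E)%E] |)%fset.

Definition limit_pairing {R : realType} (E : R -> R) (b T : R) (phi : R -> R) : R :=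
  b * \sum_(1 <= i < (num_hits E b T).+1) phi (fine (hitting_time E b i)).

(* phi in C_c^oo(0,oo) (extended by 0 to R) *)
Definition test_function {R : realType} (phi : R -> R) : Prop :=
  (forall n x, derivable (derive1n n phi) x 1) /\
  exists a c : R, [/\ 0 < a, a <= c & forall t, (t < a \/ c < t) -> phi t = 0].

(* Main.v *)
(** Fix a Brownian path and write [E t = m t + D0 W t].  In a down phase the drift [- r / eps]
    brings [q] from [b] to [0] in time [O(eps)], and the mass [r / eps] times its duration is
    [b + D1 (W s' - W s)], which tends to [b].  In an up phase [E] gains exactly [b].  Hence, as
    [eps] tends to [0], the [k]-th down phase shrinks to the first hitting time of [k b] by [E],
    provided that [E] exceeds [k b] immediately after hitting it and that [E T] is not a
    multiple of [b].  This holds almost surely because the maximum [M] of [E] over [[0, q]] has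
    no atom [x > 0]: on the event that [E < x] on [[0, h]], [M = x] forces
    [E h = x - max_([h, q]) (E - E h)], where the right-hand side is independent of [E h], whose
    law has a bounded density.

    To pass to the limit in mean square the pairings must be dominated uniformly in [eps].  Each
    up phase lasts at least as long as [E] needs to increase by [b], so the number of phases is
    bounded through the modulus of continuity of [W]: if [W] is 1/3-Hoelder with constant [k], it
    is [O((1 + k)^3)] and the squared pairings are [O(1 + k^8)].  A chaining argument bounds
    [k^8] by a series of eighth powers of Gaussian increments, with finite expectation. *)

Require Import Defs.
From HB Require Import structures.
From mathcomp Require Import all_boot all_order all_algebra.
From mathcomp Require Import finmap all_classical all_reals all_analysis.
From mathcomp Require Import measurable_realfun.
From mathcomp Require Import ring lra zify.
Set Implicit Arguments. Unset Strict Implicit. Unset Printing Implicit Defensive.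
Import Order.TTheory GRing.Theory Num.Theory.
Import numFieldNormedType.Exports.
Local Open Scope classical_set_scope.
Local Open Scope ring_scope.

(** * Hitting times *)

(** Stated by properties, with no infimum and no infinite value. Time 0 is allowed, so that level 0
    is hit at time 0 and the first up phase starts at a hitting time like the others. *)
Definition first_hit {R : realType} (E : R -> R) (x t : R) : Prop :=
  [/\ 0 <= t, E t = x & forall s, 0 <= s -> s < t -> E s < x].

Lemma continuous_near_lt {R : realType} (f : R -> R) (t x : R) :
  continuous f -> f t < x ->
  exists2 e, 0 < e & forall s, `|s - t| < e -> f s < x.
Proof.
move=> cf ftx.
have /nbhs_ballP[e /= e0 H] : \forall s \near t, f s < x.
  exact: (cvgr_lt (f t) (cf t)).
by exists e => // s st; apply: H; rewrite /ball /= distrC.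
Qed.

Lemma continuous_near_gt {R : realType} (f : R -> R) (t x : R) :
  continuous f -> x < f t ->
  exists2 e, 0 < e & forall s, `|s - t| < e -> x < f s.
Proof.
move=> cf ftx.
have /nbhs_ballP[e /= e0 H] : \forall s \near t, x < f s.
  exact: (cvgr_gt (f t) (cf t)).
by exists e => // s st; apply: H; rewrite /ball /= distrC.
Qed.

(** The infimum of the times at which [E] is at least [x] works: by continuity [x <= E] still holds
    there, and a strict excess would propagate to earlier times. *)
Lemma first_hit_exists {R : realType} (E : R -> R) (x t : R) :
  continuous E -> E 0 <= x -> 0 <= t -> x <= E t ->
  exists2 u, u <= t & first_hit E x u.
Proof.
move=> cE E0 t0 xEt.
pose A := [set s | 0 <= s /\ x <= E s].
have A0 : has_inf A.
  by split; [exists t | exists 0 => s []].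
have At : A t by [].
have lbA : lbound A (inf A) by apply: ge_inf; case: A0.
have inf0 : 0 <= inf A by apply: lb_le_inf; [case: A0 | move=> s []].
have xE : x <= E (inf A).
  rewrite leNgt; apply/negP => /(continuous_near_lt cE)[e e0 He].
  have [s As sA] := inf_adherent e0 A0.
  have := lbA s As; case: As => s0 xs sinf.
  have : E s < x by apply: He; rewrite ger0_norm; lra.
  by rewrite ltNge xs.
have before s : 0 <= s -> s < inf A -> E s < x.
  move=> s0 sA; rewrite ltNge; apply/negP => xs.
  by have := lbA s (conj s0 xs); lra.
exists (inf A); first exact: lbA.
split => //; apply/eqP; rewrite eq_le xE andbT.
(* At time 0 there is no earlier time to appeal to; the hypothesis [E 0 <= x] takes over. *)
have [->//|/eqP inf_neq] := eqVneq (inf A) 0.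
have inf_gt : 0 < inf A by rewrite lt_neqAle inf0 eq_sym andbT; apply/eqP.
rewrite leNgt; apply/negP => /(continuous_near_gt cE)[e e0 He].
pose s := Num.max 0 (inf A - e / 2).
have s0 : 0 <= s by rewrite /s le_max lexx.
have sA : s < inf A by rewrite /s gt_max inf_gt /=; lra.
have : x < E s.
  apply: He; rewrite ltr0_norm; last lra.
  have : inf A - e / 2 <= s by rewrite /s le_max lexx orbT.
  lra.
by have := before _ s0 sA; lra.
Qed.

Lemma lt_on_segment_gap {R : realType} (f : R -> R) (a x : R) :
  continuous f -> 0 <= a -> (forall t, 0 <= t -> t <= a -> f t < x) ->
  exists2 e, 0 < e & forall t, 0 <= t -> t <= a -> f t + e < x.
Proof.
move=> cf a0 H.
have [|c cin Hc] := @EVT_max R f 0 a a0.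
  exact: continuous_subspaceT.
move: cin; rewrite in_itv /= => /andP[c0 ca].
exists ((x - f c) / 2); first by have := H _ c0 ca; lra.
move=> t t0 ta; have := Hc t; rewrite in_itv /= t0 ta => /(_ isT).
by have := H _ c0 ca; lra.
Qed.

(** Paths are only controlled at nonnegative times: [F] is meant to be the given path and [E] its
    continuous extension to the line. Only positive times enter the infimum, so agreement there
    suffices. *)
Lemma hitting_time_first_hit {R : realType} (E F : R -> R) (b : R) (k : nat) (u : R) :
  (forall t, 0 < t -> F t = E t) -> E 0 < k%:R * b -> first_hit E (k%:R * b) u ->
  hitting_time F b k = u%:E.
Proof.
move=> FE E0 [u0 Eu before].
have u_gt : 0 < u.
  rewrite lt_neqAle u0 andbT; apply/eqP => u0'.
  by move: E0; rewrite u0' Eu ltxx.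
apply/eqP; rewrite eq_le; apply/andP; split.
  by apply: ereal_inf_lbound; exists u => //=; rewrite FE.
apply: le_ereal_inf_tmp => _ [t /= [t0 Et] <-].
rewrite lee_fin leNgt; apply/negP => tu.
by have := before t (ltW t0) tu; rewrite -FE // Et ltxx.
Qed.

Lemma hitting_time_gt {R : realType} (E F : R -> R) (b T : R) (k : nat) :
  continuous E -> (forall t, 0 < t -> F t = E t) -> E 0 < k%:R * b ->
  (forall t, 0 <= t -> t <= T -> E t < k%:R * b) ->
  (T%:E < hitting_time F b k)%E.
Proof.
move=> cE FE E0 below.
have [[t [t0 Et]]|noS] := pselect (exists t, 0 < t /\ E t = k%:R * b).
  have [|u _ hu] := @first_hit_exists R E (k%:R * b) t cE (ltW E0) (ltW t0).
    by rewrite Et.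
  rewrite (hitting_time_first_hit FE E0 hu) lte_fin ltNge; apply/negP => uT.
  by case: hu => u0 Eu _; have := below _ u0 uT; rewrite Eu ltxx.
rewrite /hitting_time (_ : [set _ | _ in _] = set0) ?ereal_inf0 ?ltry //.
rewrite -subset0 => _ [t /= [t0 Et] _]; apply: noS; exists t; split => //.
by rewrite -FE.
Qed.

(** When [E 0 = 0] and [0 < b], [N] is the number of levels [b, 2 b, ...] reached by time [T]. Index
    0 is kept as the start of the first up phase, and [tau] is unconstrained beyond [N]. *)
Definition hits {R : realType} (E : R -> R) (b T : R) (N : nat) (tau : nat -> R) : Prop :=
  (forall k, (k <= N)%N -> tau k <= T /\ first_hit E (k%:R * b) (tau k)) /\
  (forall t, 0 <= t -> t <= T -> E t < N.+1%:R * b).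

(** Take the least [N] such that [E] stays below [N.+1%:R * b] on [[0, T]]: one exists because [E]
    is bounded there, and minimality forces every level up to [N b] to be reached. *)
Lemma hits_exist {R : realType} (E : R -> R) (b T : R) :
  continuous E -> E 0 = 0 -> 0 < b -> 0 <= T -> exists N tau, hits E b T N tau.
Proof.
move=> cE E0 b0 T0.
pose P n := `[< forall t, 0 <= t -> t <= T -> E t < n.+1%:R * b >].
have exP : exists n, P n.
  have [|c cin Hc] := @EVT_max R E 0 T T0.
    exact: continuous_subspaceT.
  exists (Num.truncn (E c / b)); apply/asboolP => t t0 tT.
  apply: (@le_lt_trans _ _ (E c)); first by apply: Hc; rewrite in_itv /= t0 tT.
  by rewrite -ltr_pdivrMr //; exact: truncnS_gt.
case: (ex_minnP exP) => N /asboolP PN minN.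
have ex k : exists u, (k <= N)%N -> u <= T /\ first_hit E (k%:R * b) u.
  have [kN|kN] := leqP k N; last by exists 0.
  suff [t [t0 tT kt]] : exists t, [/\ 0 <= t, t <= T & k%:R * b <= E t].
    have [|u ut hu] := @first_hit_exists R E (k%:R * b) t cE _ t0 kt.
      by rewrite E0 mulr_ge0 // ltW.
    by exists u => _; split => //; exact: le_trans tT.
  case: k kN => [|k] kN; first by exists 0; rewrite mul0r E0.
  apply: contrapT => no.
  have : P k.
    apply/asboolP => t t0 tT; rewrite ltNge; apply/negP => ?.
    by apply: no; exists t.
  by move/minN; rewrite leqNgt kN.
have [tau Htau] := choice ex.
by exists N, tau.
Qed.

Lemma hits0 {R : realType} (E : R -> R) (b T : R) N tau :
  E 0 = 0 -> hits E b T N tau -> tau 0%N = 0.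
Proof.
move=> E0 [/(_ 0%N (leq0n _))[_ [t0 _ before]] _].
apply/eqP; rewrite eq_le t0 andbT leNgt; apply/negP => tau0.
by have := before 0 (lexx _) tau0; rewrite E0 mul0r ltxx.
Qed.

Lemma card_fset_set_initial (N : nat) (A : set nat) :
  (forall k, A k <-> (0 < k <= N)%N) -> #|` fset_set A|%fset = N.
Proof.
move=> HA; apply: card_fset_set.
rewrite (_ : A = S @` `I_N); first by apply: inj_card_eq => x y _ _ [].
apply/seteqP; split => k /=.
  by move/HA; case: k => // k /= kN; exists k.
by move=> [j jN <-]; apply/HA.
Qed.

Lemma limit_pairing_hits {R : realType} (E F : R -> R) (b T : R) N tau (phi : R -> R) :
  continuous E -> E 0 = 0 -> 0 < b -> (forall t, 0 < t -> F t = E t) ->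
  hits E b T N tau ->
  limit_pairing F b T phi = b * \sum_(j < N) phi (tau j.+1).
Proof.
move=> cE E0 b0 FE [Htau below].
have E0k k : E 0 < k.+1%:R * b by rewrite E0 mulr_gt0.
have hitE k : (k < N)%N -> hitting_time F b k.+1 = (tau k.+1)%:E.
  by move=> /Htau[_ /(hitting_time_first_hit FE (E0k k))].
have numE : num_hits F b T = N.
  apply: card_fset_set_initial => -[|k] /=; first by split=> [[]|].
  split=> [[_]|kN]; last by split; rewrite // hitE // lee_fin; case: (Htau _ kN).
  rewrite ltnNge => Hk; apply/negP => kN; move: Hk; apply/negP; rewrite -ltNge.
  apply: (hitting_time_gt cE FE (E0k k)) => t t0 tT.
  apply: lt_le_trans (below t t0 tT) _.
  by rewrite ler_pM2r // ler_nat ltnS.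
rewrite /limit_pairing numE big_add1 /= big_mkord; congr (_ * _).
by apply: eq_bigr => i _; rewrite hitE.
Qed.

(** * Switching times *)

(** The switching times of a solution with [q] eliminated: in an up phase [q] is an increment of
    [E], and [c] stands for [r / eps]. Everything is cut off at [K], the first index whose switching
    time exceeds [T]. *)
Definition switching {R : realType} (c b D1 T : R) (E w : R -> R) (s : nat -> R)
    (K : nat) : Prop :=
  [/\ s 0%N = 0,
      forall k, (k < K)%N -> s k <= T /\ s k < s k.+1,
      T < s K,
      (forall j t, (j.*2 < K)%N -> s j.*2 <= t -> t < s j.*2.+1 -> t <= T ->
         E t < E (s j.*2) + b) /\
      (forall j, (j.*2.+1 < K)%N -> E (s j.*2.+1) = E (s j.*2) + b) &
      (forall j t, (j.*2.+1 < K)%N -> s j.*2.+1 <= t -> t < s j.*2.+2 -> t <= T ->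
         c * (t - s j.*2.+1) < b + D1 * (w t - w (s j.*2.+1))) /\
      (forall j, (j.*2.+2 < K)%N ->
         c * (s j.*2.+2 - s j.*2.+1) = b + D1 * (w (s j.*2.+2) - w (s j.*2.+1)))].

(** The part up to [T] of a down phase, kept as one interval with a variable right end so that the
    results on integrals over intervals apply. *)
Definition down_itv {R : realType} (T : R) (s : nat -> R) (j : nat) : interval R :=
  Interval (BLeft (s j.*2.+1)) (if s j.*2.+2 <= T then BLeft (s j.*2.+2) else BRight T).

Lemma in_down_itv {R : realType} (T : R) (s : nat -> R) (j : nat) (t : R) :
  (t \in down_itv T s j) = [&& s j.*2.+1 <= t, t < s j.*2.+2 & t <= T].
Proof.
rewrite /down_itv; case: ifPn => [sT|sT]; rewrite in_itv /=; congr (_ && _).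
  by apply/idP/andP => [ts|[]//]; split => //; apply: ltW; exact: lt_le_trans sT.
apply/idP/andP => [tT|[]//]; split => //; apply: le_lt_trans tT _.
by rewrite ltNge.
Qed.

Lemma switching_le {R : realType} (c b D1 T : R) (E w : R -> R) s K :
  switching c b D1 T E w s K ->
  forall i j, (i <= j)%N -> (j <= K)%N -> s i <= s j.
Proof.
move=> [_ inc _ _ _] i j; elim: j => [|j IH]; first by rewrite leqn0 => /eqP ->.
rewrite leq_eqVlt => /predU1P[->//|]; rewrite ltnS => ij jK.
by apply: le_trans (IH ij (ltnW jK)) _; apply: ltW; case: (inc _ jK).
Qed.

Lemma switching_ge0 {R : realType} (c b D1 T : R) (E w : R -> R) s K :
  switching c b D1 T E w s K -> forall i, (i <= K)%N -> 0 <= s i.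
Proof.
move=> sw i iK; have [s0 _ _ _ _] := sw; rewrite -s0.
exact: (switching_le sw).
Qed.

Lemma switching_cover {R : realType} (c b D1 T : R) (E w : R -> R) s K :
  switching c b D1 T E w s K ->
  forall t, 0 <= t -> t <= T -> exists k, [/\ (k < K)%N, s k <= t & t < s k.+1].
Proof.
move=> sw t t0 tT; have [s0 inc TK _ _] := sw.
have exP : exists n, t < s n by exists K; exact: le_lt_trans TK.
case: (ex_minnP exP) => -[|n] tn minn; first by move: tn; rewrite s0; lra.
exists n; split => //.
  by apply: minn; exact: le_lt_trans TK.
rewrite leNgt; apply/negP => /minn; by rewrite ltnn.
Qed.

(* [switched_solution] does not order the switching times that follow the first one after [T],
   namely [s K]; so only the indices up to [K] can be used. *)
Lemma switched_solution_switching {R : realType} (m r b D0 D1 eps T : R)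
    (w0 w q sig : R -> R) :
  0 <= T -> (forall t, 0 <= t -> w t = w0 t) ->
  switched_solution m r b D0 D1 eps T w0 q sig ->
  exists s K, [/\ switching (r / eps) b D1 T (fun t => m * t + D0 * w t) w s K,
    (forall k t, (k < K)%N -> s k <= t -> t < s k.+1 -> t <= T ->
       sig t = if odd k then r / eps else 0) &
    (forall t, T < t -> sig t = 0)].
Proof.
move=> T0 ww0 [s [s0 [inc [exK [up [hitb [down [hit0 sigT]]]]]]]].
case: (ex_minnP exK) => K TK minK.
have leT k : (k < K)%N -> s k <= T.
  by move=> kK; rewrite leNgt; apply/negP => /minK; rewrite leqNgt kK.
have inc' k : (k < K)%N -> s k <= T /\ s k < s k.+1.
  by move=> kK; have sk := leT _ kK; split => //; exact: inc.
have ge0 k : (k <= K)%N -> 0 <= s k.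
  elim: k => [|k IH] kK; first by rewrite s0.
  by apply: le_trans (IH (ltnW kK)) (ltW _); case: (inc' _ kK).
exists s, K; split => //.
- split => //; split.
  + move=> j t jK st ts tT; have sj := ge0 _ (ltnW jK).
    rewrite !ww0 //; last exact: le_trans st.
    by have [_ ->] := up j t st ts tT; lra.
  + move=> j jK; have := hitb j (leT _ jK).
    by rewrite !ww0 ?(ge0 _ (ltnW jK)) ?(ge0 _ (ltnW (ltnW jK))) //; lra.
  + move=> j t jK st ts tT; have sj := ge0 _ (ltnW jK).
    rewrite !ww0 //; last exact: le_trans st.
    by have [_ ->] := down j t st ts tT; lra.
  + move=> j jK; have := hit0 j (leT _ jK).
    by rewrite !ww0 ?(ge0 _ (ltnW jK)) ?(ge0 _ (ltnW (ltnW jK))) //; lra.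
- move=> k t kK; rewrite -(odd_double_half k); case: (odd k) => /= st ts tT.
    rewrite oddD odd_double /=; rewrite !add1n in st ts.
    by have [] := down _ t st ts tT.
  rewrite oddD odd_double /=; rewrite !add0n in st ts.
  by have [] := up _ t st ts tT.
Qed.

(** * Pairings as sums over down phases; lengths and numbers of phases *)

Lemma integrable_itv_continuous {R : realType} (f : R -> R) (i : interval R) (a e : R) :
  continuous f -> {subset i <= `[a, e]} ->
  (@lebesgue_measure R).-integrable [set` i] (EFin \o f).
Proof.
move=> cf sub.
have H : (@lebesgue_measure R).-integrable [set` `[a, e]] (EFin \o f).
  apply: continuous_compact_integrable; first exact: segment_compact.
  exact: continuous_subspaceT.
by apply: (integrableS _ _ _ H) => // x /= /sub.
Qed.

Lemma Rintegral_sum_integrable {R : realType} (D : set R) (n : nat) (f : nat -> R -> R) :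
  measurable D -> (forall j, (@lebesgue_measure R).-integrable D (EFin \o f j)) ->
  (\int[lebesgue_measure]_(x in D) (\sum_(j < n) f j x) =
   \sum_(j < n) \int[lebesgue_measure]_(x in D) f j x) /\
  (@lebesgue_measure R).-integrable D (EFin \o (fun x => \sum_(j < n) f j x)).
Proof.
move=> mD intf; elim: n => [|n [IH1 IH2]].
  rewrite big_ord0; under eq_Rintegral do rewrite big_ord0.
  rewrite (_ : EFin \o _ = cst 0%E); last first.
    by apply/funext => x /=; rewrite big_ord0.
  by split; [rewrite Rintegral_cst // mul0r | exact: integrable0].
rewrite big_ord_recr /= -IH1 -RintegralD //; split.
  by apply: eq_Rintegral => x _; rewrite big_ord_recr.
rewrite (_ : EFin \o _ =
  (EFin \o (fun x => \sum_(j < n) f j x)) \+ (EFin \o f n)); last first.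
  by apply/funext => x /=; rewrite big_ord_recr /= EFinD.
exact: integrableD.
Qed.

(** On [[0, +oo[] the signal is [c] times the sum of the indicators of the disjoint down intervals.
    For even [K] the last of them is cut off at [T]. *)
Lemma pairing_switching {R : realType} (c b D1 T : R) (E w : R -> R) s K
    (sig phi : R -> R) :
  continuous phi -> switching c b D1 T E w s K ->
  (forall k t, (k < K)%N -> s k <= t -> t < s k.+1 -> t <= T ->
     sig t = if odd k then c else 0) ->
  (forall t, T < t -> sig t = 0) ->
  pairing sig phi =
  \sum_(j < K./2) c * \int[lebesgue_measure]_(x in [set` down_itv T s j]) phi x.
Proof.
move=> cphi sw Hsig HT.
pose g j x := c * (phi \_ [set` down_itv T s j]) x.
have sgE x : 0 <= x -> sig x * phi x = \sum_(j < K./2) g j x.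
  move=> x0; have [xT|xT] := leP x T; last first.
    rewrite HT // mul0r big1 // => j _; rewrite /g patchE memNset ?mulr0 //=.
    by rewrite in_down_itv (leNgt x) xT !andbF.
  have [k [kK sx xs]] := switching_cover sw x0 xT.
  have only j : (j < K./2)%N -> x \in down_itv T s j -> k = j.*2.+1.
    rewrite geq_half_double doubleS => jK; rewrite in_down_itv => /and3P[x1 x2 _].
    apply/eqP; rewrite eqn_leq; apply/andP; split; rewrite leqNgt; apply/negP => kj.
      have := switching_le sw kj (ltnW kK); lra.
    have := switching_le sw kj (ltnW jK); lra.
  rewrite (Hsig k x) //; case: ifPn => ok.
    have kE : k = k./2.*2.+1 by rewrite -{1}(odd_double_half k) ok.
    have kK2 : (k./2 < K./2)%N by rewrite geq_half_double doubleS -kE.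
    rewrite (bigD1 (Ordinal kK2)) //= big1 ?addr0.
      rewrite /g patchE mem_set //= in_down_itv; apply/and3P; split => //.
        by rewrite -kE.
      by move: xs; rewrite {1}kE.
    move=> j /negP jk; rewrite /g patchE memNset ?mulr0 //= => /only -/(_ (ltn_ord j)) kj.
    apply: jk; apply/eqP/val_inj => /=; move: kj; lia.
  rewrite mul0r big1 // => j _; rewrite /g patchE memNset ?mulr0 //=.
  by move=> /only -/(_ (ltn_ord j)) kj; move: ok; rewrite kj /= odd_double.
rewrite /pairing (_ : \int[_]_(t in _) _ =
   \int[lebesgue_measure]_(t in `[0, +oo[) (\sum_(j < K./2) g j t)); last first.
  by apply: eq_Rintegral => x; rewrite inE /= in_itv /= andbT => /sgE.
have intI j : (@lebesgue_measure R).-integrable [set` down_itv T s j] (EFin \o phi).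
  apply: (@integrable_itv_continuous R phi _ (s j.*2.+1) T) => // x.
  by rewrite in_down_itv in_itv /= => /and3P[-> _ ->].
have intg j : (@lebesgue_measure R).-integrable `[0, +oo[
    (EFin \o (phi \_ [set` down_itv T s j])).
  apply: (integrableS (E := setT)) => //.
  rewrite (_ : EFin \o _ = (EFin \o phi) \_ [set` down_itv T s j]); last first.
    by apply/funext => x /=; rewrite !patchE; case: ifP.
  by rewrite -integrable_mkcond.
have intcg j : (@lebesgue_measure R).-integrable `[0, +oo[ (EFin \o g j).
  rewrite (_ : EFin \o g j = fun x =>
    (c%:E * (EFin \o (phi \_ [set` down_itv T s j])) x)%E).
    by apply: integrableZl => //; exact: measurable_itv.
  by apply/funext => x.
have [-> _] := @Rintegral_sum_integrable R [set` `[0, +oo[] K./2 g (measurable_itv _)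
  intcg.
apply: eq_bigr => j _; rewrite /g RintegralZl // -Rintegral_mkcondr.
congr (c * _); congr (Rintegral _ _ _).
apply/seteqP; split => [x []//|x /=] xI; split => //.
rewrite /= in_itv /= andbT; move: xI; rewrite in_down_itv => /and3P[x1 _ _].
apply: le_trans x1; apply: (switching_ge0 sw).
by have := ltn_ord j; rewrite geq_half_double doubleS; exact: ltnW.
Qed.

(** Comparison with the constants [x - o] and [x + o]. The side of the right end is left free
    because a down interval is closed exactly when it is cut off at [T]. *)
Lemma Rintegral_itv_dist {R : realType} (phi : R -> R) (bb : bool) (a e x o : R) :
  continuous phi -> a <= e -> (forall t, a <= t -> t <= e -> `|phi t - x| <= o) ->
  `|\int[lebesgue_measure]_(t in [set` Interval (BLeft a) (BSide bb e)]) phi t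
    - x * (e - a)| <= o * (e - a).
Proof.
move=> cphi ae H.
set I := Interval _ _.
have subI : {subset I <= `[a, e]}.
  by move=> t; rewrite !in_itv /= => /andP[-> te]; exact: lteifW te.
have cst_int y : \int[lebesgue_measure]_(t in [set` I]) (cst y) t = y * (e - a).
  rewrite Rintegral_cst // [X in fine X](lebesgue_measure_itv I) /= lte_fin.
  case: ifPn => [//|]; rewrite -leNgt => ea.
  have -> : e = a by apply/eqP; rewrite eq_le ea ae.
  by rewrite subrr.
have iphi : (@lebesgue_measure R).-integrable [set` I] (EFin \o phi).
  exact: integrable_itv_continuous subI.
have icst y : (@lebesgue_measure R).-integrable [set` I] (EFin \o cst y).
  by apply: integrable_itv_continuous subI; exact: cst_continuous.
have upper : \int[lebesgue_measure]_(t in [set` I]) phi t <= (x + o) * (e - a).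
  rewrite -cst_int; apply: le_Rintegral => // t /= /subI.
  by rewrite in_itv /= => /andP[at_ te]; move: (H _ at_ te); rewrite ler_norml; lra.
have lower : (x - o) * (e - a) <= \int[lebesgue_measure]_(t in [set` I]) phi t.
  rewrite -cst_int; apply: le_Rintegral => // t /= /subI.
  by rewrite in_itv /= => /andP[at_ te]; move: (H _ at_ te); rewrite ler_norml; lra.
move: (Rintegral _ _ _) upper lower => J upper lower.
by rewrite ler_norml; apply/andP; split; lra.
Qed.

(** Positivity of [q] during the phase reads [c (t - s) < b + D1 (w t - w s)], and the right-hand
    side is at most [b + D1 * O]. Hence the elapsed time is [O(1 / c)], also in a phase cut off at
    [T]. *)
Lemma down_duration {R : realType} (c b D1 T O : R) (E w : R -> R) s K j e :
  0 < c -> 0 < b -> 0 <= D1 -> 0 <= O ->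
  (forall u v, 0 <= u -> u <= T -> 0 <= v -> v <= T -> `|w u - w v| <= O) ->
  switching c b D1 T E w s K -> (j.*2.+1 < K)%N ->
  e <= s j.*2.+2 -> e <= T -> c * (e - s j.*2.+1) <= b + D1 * O.
Proof.
move=> c0 b0 D10 O0 HO sw jK es eT; rewrite leNgt; apply/negP => ce.
have sj0 := switching_ge0 sw (ltnW jK).
have [_ inc _ _ [down _]] := sw.
have [sjT _] := inc _ jK.
set B := b + D1 * O in ce.
have B0 : 0 <= B by rewrite addr_ge0 ?mulr_ge0 // ltW.
(* If the bound failed, this time would still belong to the phase, while the drift alone would
   already have used up [B]. *)
pose t := s j.*2.+1 + B / c.
have te : t < e by rewrite /t -ltrBrDl ltr_pdivrMr // mulrC.
have st : s j.*2.+1 <= t by rewrite /t lerDl divr_ge0 // ltW.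
have := down j t jK st (lt_le_trans te es) (ltW (lt_le_trans te eT)).
have -> : c * (t - s j.*2.+1) = B by rewrite /t addrAC subrr add0r mulrC divfK ?gt_eqF.
apply/negP; rewrite -leNgt /B lerD2l ler_wpM2l //.
apply: le_trans (ler_norm _) _; apply: HO => //.
- exact: le_trans st.
- exact: ltW (lt_le_trans te eT).
Qed.

(** The bound does not involve [c]: a short phase compensates a large signal. This makes the later
    domination uniform in [eps]. *)
Lemma down_term_bound {R : realType} (c b D1 T O F : R) (E w phi : R -> R) s K j :
  continuous phi -> (forall t, `|phi t| <= F) ->
  0 < c -> 0 < b -> 0 <= D1 -> 0 <= O ->
  (forall u v, 0 <= u -> u <= T -> 0 <= v -> v <= T -> `|w u - w v| <= O) ->
  switching c b D1 T E w s K -> (j.*2.+1 < K)%N ->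
  `|c * \int[lebesgue_measure]_(x in [set` down_itv T s j]) phi x| <= F * (b + D1 * O).
Proof.
move=> cphi HF c0 b0 D10 O0 HO sw jK.
have F0 : 0 <= F by apply: le_trans (HF 0).
have [_ inc _ _ _] := sw.
have [sT ss] := inc _ jK.
rewrite normrM gtr0_norm //.
have key bb e : s j.*2.+1 <= e -> e <= s j.*2.+2 -> e <= T ->
    c * `|\int[lebesgue_measure]_(x in [set` Interval (BLeft (s j.*2.+1)) (BSide bb e)])
      phi x| <= F * (b + D1 * O).
  move=> se es eT.
  have := @Rintegral_itv_dist R phi bb (s j.*2.+1) e 0 F cphi se.
  rewrite mul0r subr0 => H.
  apply: (@le_trans _ _ (c * (F * (e - s j.*2.+1)))).
    by rewrite ler_pM2l //; apply: H => t _ _; rewrite subr0.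
  rewrite mulrCA ler_wpM2l //.
  exact: (down_duration c0 b0 D10 O0 HO sw jK es eT).
rewrite /down_itv; case: ifPn => [sT'|]; first exact: key (ltW ss) (lexx _) sT'.
by rewrite -ltNge => sT'; apply: key => //; exact: ltW.
Qed.

(** An up phase raises [E] by exactly [b], which takes longer than [h]; [K./2] counts the up phases
    completed by [T], one before each down phase. *)
Lemma cycle_count {R : realType} (c b D1 T h : R) (E w : R -> R) s K :
  0 <= h -> 0 <= T ->
  (forall u v, 0 <= u -> u <= v -> v <= T -> v - u <= h -> E v < E u + b) ->
  switching c b D1 T E w s K -> (K./2)%:R * h <= T.
Proof.
move=> h0 T0 osc sw; have [_ inc _ [_ hitb] _] := sw.
have count j : (j.*2.+1 < K)%N -> j.+1%:R * h <= s j.*2.+1.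
  elim: j => [|j IH] jK.
    rewrite mul1r leNgt; apply/negP => sh; have [s0 _ _ _ _] := sw.
    have [s1T s01] := inc _ jK; have [_ s01'] := inc _ (ltnW jK).
    have := osc (s 0%N) (s 1%N); rewrite -(hitb 0%N) // ltxx => H.
    by have : false by apply: H; rewrite ?s0 // ?subr0 ltW // -s0.
  have jK' : (j.*2.+1 < K)%N by apply: leq_trans jK; rewrite doubleS; lia.
  have IHj := IH jK'; rewrite -natr1 mulrDl mul1r leNgt; apply/negP => sh.
  have [s3T _] := inc _ jK.
  have [_ s23] := inc _ (ltnW jK).
  have s12 : s j.*2.+1 <= s j.+1.*2 by apply: (switching_le sw) => //; exact: ltnW.
  have := osc (s j.+1.*2) (s j.+1.*2.+1); rewrite -(hitb j.+1) // ltxx => H.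
  have : false by apply: H; [exact: switching_ge0 sw _ (ltnW (ltnW jK)) | exact: ltW| | lra].
  by [].
case: (posnP K./2) => [->|]; first by rewrite mul0r.
case E2 : K./2 => [//|n] _.
have nK : (n.*2.+1 < K)%N by rewrite -doubleS -geq_half_double E2.
by apply: le_trans (count _ nK) _; case: (inc _ nK).
Qed.

(** The same count along consecutive hitting times, between which [E] also gains [b]. *)
Lemma hits_count {R : realType} (b T h : R) (E : R -> R) N tau :
  0 <= h -> (forall u v, 0 <= u -> u <= v -> v <= T -> v - u <= h -> E v < E u + b) ->
  0 < b -> hits E b T N tau -> N%:R * h <= T.
Proof.
move=> h0 osc b0 [Htau _].
suff H k : (k <= N)%N -> k%:R * h <= tau k.
  by apply: le_trans (H _ (leqnn _)) _; case: (Htau _ (leqnn N)).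
elim: k => [|k IH] kN.
  by rewrite mul0r; case: (Htau _ kN) => _ [].
have IHk := IH (ltnW kN); have [tT [t0 Et bef]] := Htau _ kN.
have [_ [u0 Eu befu]] := Htau _ (ltnW kN).
have tu : tau k <= tau k.+1.
  rewrite leNgt; apply/negP => tu; have := befu _ t0 tu; rewrite Et ltNge.
  by rewrite ler_pM2r // ler_nat leqnSn.
rewrite -natr1 mulrDl mul1r leNgt; apply/negP => hh.
have := osc (tau k) (tau k.+1) u0 tu tT; rewrite Et Eu -natr1 mulrDl mul1r ltxx => H.
by have : false by apply: H; lra.
Qed.

(** * Convergence along a path *)

(** From above: a time [t] just after [t1] with [E t] beyond the level forces the switch by [t].
    From below: up to [t1 - d] the path stays a fixed gap under the level [E t0 + b], to which the
    actual threshold [E (s n k.*2) + b] converges. *)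
Lemma up_step {R : realType} (b D1 T t0 t1 : R) (E w : R -> R) (c : nat -> R)
    (s : nat -> nat -> R) (K : nat -> nat) (k : nat) :
  continuous E -> (forall n, switching (c n) b D1 T E w (s n) (K n)) ->
  (\forall n \near \oo, (k.*2 < K n)%N) -> s n k.*2 @[n --> \oo] --> t0 ->
  first_hit E (E t0 + b) t1 -> t0 < t1 -> t1 < T ->
  (forall d, 0 < d -> exists t, [/\ t1 < t, t < t1 + d & E t0 + b < E t]) ->
  (\forall n \near \oo, (k.*2.+1 < K n)%N) /\ s n k.*2.+1 @[n --> \oo] --> t1.
Proof.
move=> cE sw kK st0 [t1_0 Et1 before] t01 t1T cross.
have Est0 : E (s n k.*2) @[n --> \oo] --> E t0.
  by apply: continuous_cvg => //; exact: cE.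
have main d : 0 < d ->
    \forall n \near \oo, (k.*2.+1 < K n)%N /\ `|t1 - s n k.*2.+1| < d.
  move=> d0.
  (* The crossing is sought before [T], where the switching conditions are still in force. *)
  have [|t [t1t td Et]] := cross (Num.min d (T - t1)).
    by rewrite lt_min d0 subr_gt0.
  have tT : t < T.
    by apply: lt_le_trans td _; rewrite -lerBrDl ge_min lexx orbT.
  have {}td : t < t1 + d.
    by apply: lt_le_trans td _; rewrite lerD2l ge_min lexx.
  have [e e0 He] : exists2 e, 0 < e &
      forall u, 0 <= u -> u <= t1 - d -> E u + e < E t0 + b.
    have [td0|td0] := leP 0 (t1 - d).
      have [|e e0 He] := lt_on_segment_gap (x := E t0 + b) cE td0; last by exists e.
      by move=> u u0 ud; apply: before => //; lra.
    by exists 1 => // u; lra.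
  near=> n.
  have kKn : (k.*2 < K n)%N by near: n.
  have E1 : E t0 - e < E (s n k.*2).
    by near: n; apply: (cvgr_gt (E t0)) => //; lra.
  have E2 : E (s n k.*2) < E t - b.
    by near: n; apply: (cvgr_lt (E t0)) => //; lra.
  have st : s n k.*2 < t.
    by near: n; apply: (cvgr_lt t0) => //; lra.
  have [_ inc TK [up hitb] _] := sw n.
  have s1t : s n k.*2.+1 <= t.
    rewrite leNgt; apply/negP => ts.
    by have := up k t kKn (ltW st) ts (ltW tT); lra.
  have kK1 : (k.*2.+1 < K n)%N.
    rewrite ltn_neqAle kKn andbT; apply/negP => /eqP kE.
    by move: TK; rewrite -kE; lra.
  split => //.
  have s10 := switching_ge0 (sw n) kKn.
  have lower : t1 - d < s n k.*2.+1.
    rewrite ltNge; apply/negP => sd.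
    by have := He _ s10 sd; rewrite hitb //; lra.
  by rewrite ltr_norml; apply/andP; split; lra.
split.
  by have := main 1 ltr01; apply: filterS => n [].
by apply/cvgrPdist_lt => d /main; apply: filterS => n [].
Unshelve. all: by end_near. Qed.

(** The duration is at most [(b + D1 * O) / c n], which tends to 0; since [t1 < T], the phase also
    ends before [T] for large [n]. *)
Lemma down_step {R : realType} (b D1 T t1 O : R) (E w : R -> R) (c : nat -> R)
    (s : nat -> nat -> R) (K : nat -> nat) (k : nat) :
  0 < b -> 0 <= D1 -> 0 <= O -> (forall n, 0 < c n) -> c n @[n --> \oo] --> +oo ->
  (forall u v, 0 <= u -> u <= T -> 0 <= v -> v <= T -> `|w u - w v| <= O) ->
  (forall n, switching (c n) b D1 T E w (s n) (K n)) ->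
  (\forall n \near \oo, (k.*2.+1 < K n)%N) -> s n k.*2.+1 @[n --> \oo] --> t1 ->
  t1 < T ->
  (\forall n \near \oo, (k.*2.+2 < K n)%N) /\ s n k.*2.+2 @[n --> \oo] --> t1.
Proof.
move=> b0 D10 O0 c0 cy HO sw kK st1 t1T.
have main d : 0 < d ->
    \forall n \near \oo, (k.*2.+2 < K n)%N /\ `|t1 - s n k.*2.+2| < d.
  move=> d0; near=> n.
  have kKn : (k.*2.+1 < K n)%N by near: n.
  have [_ inc TK _ _] := sw n.
  have [sT ss] := inc _ kKn.
  have dur e := down_duration (e := e) (c0 n) b0 D10 O0 HO (sw n) kKn.
  have cd : (b + D1 * O) / (d / 2) < c n.
    by near: n; move/cvgryPgt: cy; apply.
  have cT : (b + D1 * O) / ((T - t1) / 2) < c n.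
    by near: n; move/cvgryPgt: cy; apply.
  rewrite ltr_pdivrMr in cd; last lra.
  rewrite ltr_pdivrMr in cT; last lra.
  have s1 : s n k.*2.+1 < t1 + Num.min (d / 2) ((T - t1) / 2).
    by near: n; apply: (cvgr_lt t1) => //; rewrite ltrDl lt_min; lra.
  have s2 : t1 - d < s n k.*2.+1.
    by near: n; apply: (cvgr_gt t1) => //; lra.
  have sd : s n k.*2.+1 < t1 + d / 2.
    by apply: lt_le_trans s1 _; rewrite lerD2l ge_min lexx.
  have {s1}sT2 : s n k.*2.+1 < t1 + (T - t1) / 2.
    by apply: lt_le_trans s1 _; rewrite lerD2l ge_min lexx orbT.
  have s'T : s n k.*2.+2 <= T.
    rewrite leNgt; apply/negP => Ts.
    have := dur T (ltW Ts) (lexx _); have := c0 n; nra.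
  have kK2 : (k.*2.+2 < K n)%N.
    rewrite ltn_neqAle kKn andbT; apply/negP => /eqP kE.
    by move: TK; rewrite -kE; lra.
  split => //.
  have upper : s n k.*2.+2 - s n k.*2.+1 < d / 2.
    rewrite ltNge; apply/negP => ds.
    have := dur _ (lexx _) s'T; have := c0 n; nra.
  by rewrite ltr_norml; apply/andP; split; lra.
split.
  by have := main 1 ltr01; apply: filterS => n [].
by apply/cvgrPdist_lt => d /main; apply: filterS => n [].
Unshelve. all: by end_near. Qed.

(** The measures of density [c n] on [[u n, v n[] have mass tending to [b] and concentrate at [t],
    so they tend weakly to [b] times the Dirac mass at [t]. *)
Lemma Rintegral_itv_scaled_cvg {R : realType} (phi : R -> R) (u v c : nat -> R) (t b : R) :
  continuous phi -> (forall n, 0 < c n) -> (\forall n \near \oo, u n <= v n) ->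
  u n @[n --> \oo] --> t -> v n @[n --> \oo] --> t ->
  c n * (v n - u n) @[n --> \oo] --> b ->
  c n * (\int[lebesgue_measure]_(x in [set` `[u n, v n[]) phi x) @[n --> \oo]
    --> b * phi t.
Proof.
move=> cphi c0 uv ut vt cb.
apply/cvgrPdist_lt => e e0.
(* The mass is eventually below [|b| + 1], so an oscillation [o] of [phi] costs less than
   [e / 2]. *)
pose o := e / 2 / (`|b| + 1).
have b1 : 0 < `|b| + 1 by rewrite ltr_wpDl.
have o0 : 0 < o by rewrite /o !divr_gt0.
have /cvgrPdist_lt/(_ _ o0) Hphi := cphi t.
have cbp : c n * (v n - u n) * phi t @[n --> \oo] --> b * phi t by apply: cvgMl.
have [d /= d0 Hd] := Hphi.
near=> n.
have uvn : u n <= v n by near: n.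
have near_phi x : u n <= x -> x <= v n -> `|phi x - phi t| <= o.
  move=> ux xv; rewrite distrC; apply: ltW; apply: Hd; rewrite /= ltr_norml.
  have : t - d < u n by near: n; apply: (cvgr_gt t) => //; lra.
  have : v n < t + d by near: n; apply: (cvgr_lt t) => //; lra.
  by move=> *; apply/andP; split; lra.
have H1 := Rintegral_itv_dist true cphi uvn near_phi.
have H2 : `|b * phi t - c n * (v n - u n) * phi t| < e / 2.
  by near: n; move/cvgrPdist_lt: cbp; apply; rewrite divr_gt0.
have H3 : c n * (v n - u n) < `|b| + 1.
  near: n; apply: (cvgr_lt b) => //; have := ler_norm b; lra.
have cn0 := c0 n.
move: H1; move: (Rintegral _ _ _) => J H1.
have -> : b * phi t - c n * J =
  (b * phi t - c n * (v n - u n) * phi t) - c n * (J - phi t * (v n - u n)) by ring.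
apply: le_lt_trans (ler_normB _ _) _.
rewrite normrM (gtr0_norm cn0).
have : c n * `|J - phi t * (v n - u n)| <= o * (c n * (v n - u n)).
  by rewrite mulrCA ler_pM2l.
have : o * (c n * (v n - u n)) < o * (`|b| + 1) by rewrite ltr_pM2l.
have -> : o * (`|b| + 1) = e / 2 by rewrite /o divfK // gt_eqF.
lra.
Unshelve. all: by end_near. Qed.

(** Alternating [up_step] and [down_step] sends both ends of each down phase to the same hitting
    time. Eventually there are exactly [N] down phases, all complete, and the sum converges term by
    term. *)
Lemma pairing_sum_cvg {R : realType} (b D1 T O : R) (E w phi : R -> R) N tau
    (c : nat -> R) (s : nat -> nat -> R) (K : nat -> nat) :
  continuous E -> E 0 = 0 -> continuous w -> continuous phi ->
  0 < b -> 0 <= D1 -> 0 <= O -> 0 <= T ->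
  (forall u v, 0 <= u -> u <= T -> 0 <= v -> v <= T -> `|w u - w v| <= O) ->
  (forall k, (0 < k)%N -> E T <> k%:R * b) ->
  (forall k t d, (0 < k)%N -> first_hit E (k%:R * b) t -> 0 < d ->
     exists u, [/\ t < u, u < t + d & k%:R * b < E u]) ->
  hits E b T N tau ->
  (forall n, 0 < c n) -> c n @[n --> \oo] --> +oo ->
  (forall n, switching (c n) b D1 T E w (s n) (K n)) ->
  (\sum_(j < (K n)./2) c n *
     \int[lebesgue_measure]_(x in [set` down_itv T (s n) j]) phi x) @[n --> \oo] -->
  b * \sum_(j < N) phi (tau j.+1).
Proof.
move=> cE E0 cw cphi b0 D10 O0 T0 HO ET cross Hh c0 cy sw.
have tau0 := hits0 E0 Hh.
have [Htau below] := Hh.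
have tauT k : (0 < k <= N)%N -> tau k < T.
  move=> /andP[k0 kN]; have [tT [_ Et _]] := Htau _ kN.
  rewrite lt_neqAle tT andbT; apply/negP => /eqP tE.
  by apply: (ET k k0); rewrite -tE.
have Etau k : (k <= N)%N -> E (tau k) = k%:R * b by move=> /Htau[_ []].
have tau_lt k : (k < N)%N -> tau k < tau k.+1.
  move=> kN; rewrite ltNge; apply/negP => tk.
  have [_ [t0 Et _]] := Htau _ kN; have [_ [_ Eu befu]] := Htau _ (ltnW kN).
  have : tau k.+1 <> tau k.
    by move=> tE; move: Et; rewrite tE Eu => /(mulIf (lt0r_neq0 b0)) /eqP; rewrite eqr_nat; lia.
  move/eqP => ne; have {}tk : tau k.+1 < tau k by rewrite lt_neqAle ne.
  have := befu _ t0 tk; rewrite Et ltNge.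
  by rewrite ler_pM2r // ler_nat leqnSn.
have up k : (k < N)%N -> (\forall n \near \oo, (k.*2 < K n)%N) ->
    s n k.*2 @[n --> \oo] --> tau k ->
    (\forall n \near \oo, (k.*2.+1 < K n)%N) /\
    s n k.*2.+1 @[n --> \oo] --> tau k.+1.
  move=> kN kK sk.
  have Eb : E (tau k) + b = k.+1%:R * b by rewrite Etau ?(ltnW kN) // -natr1 mulrDl mul1r.
  apply: (up_step cE sw kK sk); rewrite ?Eb.
  - by case: (Htau _ kN).
  - exact: tau_lt.
  - exact: tauT.
  - by move=> d d0; apply: cross => //; case: (Htau _ kN).
have even k : (k <= N)%N -> (\forall n \near \oo, (k.*2 < K n)%N) /\
    s n k.*2 @[n --> \oo] --> tau k.
  elim: k => [|k IH] kN.
    split.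
      near=> n; rewrite lt0n; apply/negP => /eqP K0.
      by have [s0 _ TK _ _] := sw n; move: TK; rewrite K0 s0; lra.
    rewrite tau0 (_ : (fun n => s n 0%N) = cst 0); first exact: cvg_cst.
    by apply/funext => n; case: (sw n).
  have [kK sk] := IH (ltnW kN).
  have [kK1 sk1] := up _ kN kK sk.
  by apply: (down_step b0 D10 O0 c0 cy HO sw kK1 sk1); exact: tauT.
have odd_cvg k : (k < N)%N -> s n k.*2.+1 @[n --> \oo] --> tau k.+1.
  by move=> kN; have [kK sk] := even _ (ltnW kN); case: (up _ kN kK sk).
(* No switch follows the [N]-th down phase before [T]: it would require a gain of [b] from a value
   close to [N b], whereas [E] stays a fixed gap below [N.+1 b]. *)
have KE : \forall n \near \oo, K n = N.*2.+1.
  have [NK sN] := even _ (leqnn N).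
  have [e e0 He] := lt_on_segment_gap cE T0 below.
  have EsN : E (s n N.*2) @[n --> \oo] --> N%:R * b.
    by rewrite -Etau //; apply: continuous_cvg => //; exact: cE.
  near=> n.
  have NKn : (N.*2 < K n)%N by near: n.
  apply/eqP; rewrite eqn_leq NKn andbT leqNgt; apply/negP => NK1.
  have [_ inc _ [_ hitb] _] := sw n.
  have [sT _] := inc _ NK1.
  have := He _ (switching_ge0 (sw n) NKn) sT; rewrite hitb //.
  have : N%:R * b - e < E (s n N.*2).
    by near: n; apply: (cvgr_gt (N%:R * b)) => //; lra.
  by rewrite -natr1 mulrDl mul1r; lra.
have term j : (j < N)%N -> c n * (\int[lebesgue_measure]_(x in
      [set` `[s n j.*2.+1, s n j.*2.+2[]) phi x) @[n --> \oo] --> b * phi (tau j.+1).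
  move=> jN.
  have [kK' sk'] := even _ jN.
  have jK : \forall n \near \oo, (j.*2.+2 < K n)%N by [].
  apply: Rintegral_itv_scaled_cvg => //.
  - near=> n; have jKn : (j.*2.+2 < K n)%N by near: n.
    by have [_ inc _ _ _] := sw n; apply: ltW; case: (inc _ (ltnW jKn)).
  - exact: odd_cvg.
  (* In a complete down phase the mass equals [b + D1 (w s' - w s)], and the increment vanishes
     since both times have the same limit. *)
  - have wb : b + D1 * (w (s n j.*2.+2) - w (s n j.*2.+1)) @[n --> \oo] --> b.
      rewrite -[X in _ --> X]addr0; apply: cvgD; first exact: cvg_cst.
      rewrite -(mulr0 D1); apply: cvgMr.
      rewrite -(subrr (w (tau j.+1))); apply: cvgB.
        by apply: continuous_cvg => //; exact: cw.
      by apply: continuous_cvg; [exact: cw | exact: odd_cvg].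
    apply: cvg_trans wb; apply: near_eq_cvg; near=> n.
    have jKn : (j.*2.+2 < K n)%N by near: n.
    by have [_ _ _ _ [_ ->]] := sw n.
have sumcvg : (\sum_(j < N) c n * \int[lebesgue_measure]_(x in
      [set` `[s n j.*2.+1, s n j.*2.+2[]) phi x) @[n --> \oo] -->
    \sum_(j < N) b * phi (tau j.+1).
  by apply: cvg_big => [|j _]; [exact: add_continuous | exact: term].
rewrite mulr_sumr; apply: cvg_trans sumcvg; apply: near_eq_cvg; near=> n.
have KnE : K n = N.*2.+1 by near: n.
rewrite KnE /= uphalf_double; apply: eq_bigr => j _.
rewrite /down_itv; case: ifPn => // /negP[].
have [_ inc _ _ _] := sw n; suff jK : (j.*2.+2 < K n)%N by case: (inc _ jK).
by rewrite KnE ltnS -doubleS leq_double.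
Unshelve. all: by end_near. Qed.

(** * Moduli of continuity and domination *)

(* 1/3-Hoelder regularity read off at the scales [T / 8^n]; 15 = 7 + 1 + 7 is the cost of
   chaining in base 8 from two points to neighbouring grid points. *)
Definition modulus {R : realType} (T k : R) (w : R -> R) : Prop :=
  forall n u v, 0 <= u -> u <= T -> 0 <= v -> v <= T -> `|u - v| <= T / 8 ^+ n ->
    `|w u - w v| <= 15 * k / 2 ^+ n.

Definition grid {R : realType} (T : R) (n i : nat) : R := T * i%:R / 8 ^+ n.

Lemma grid_scale {R : realType} (T : R) (n i : nat) :
  grid T n.+1 (8 * i) = grid T n i.
Proof. by rewrite /grid natrM exprS; field. Qed.

Lemma grid_chain {R : realType} (T k : R) (w : R -> R) n i r :
  (forall i, (i < 8 ^ n)%N -> `|w (grid T n i.+1) - w (grid T n i)| <= k / 2 ^+ n) ->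
  (i + r <= 8 ^ n)%N -> `|w (grid T n (i + r)) - w (grid T n i)| <= r%:R * (k / 2 ^+ n).
Proof.
move=> H; elim: r => [|r IH] ir; first by rewrite addn0 subrr normr0 mul0r.
rewrite addnS in ir; have := IH (ltnW ir); have := H _ ir.
rewrite addnS -[r.+1%:R]natr1 mulrDl mul1r => H1 H2.
have := ler_distD (w (grid T n (i + r))) (w (grid T n (i + r).+1)) (w (grid T n i)).
lra.
Qed.

(** Chaining: passing from the grid point below [t] at one scale to that at the next takes at most 7
    steps, and the costs form a geometric series. Two points at distance at most [T / 8 ^+ n] have
    equal or adjacent grid points at scale [n]. *)
Lemma grid_modulus {R : realType} (T k : R) (w : R -> R) :
  continuous w -> 0 < T -> 0 <= k ->
  (forall n i, (i < 8 ^ n)%N -> `|w (grid T n i.+1) - w (grid T n i)| <= k / 2 ^+ n) ->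
  modulus T k w.
Proof.
move=> cw T0 k0 H.
have e0 n : 0 < 8 ^+ n :> R by rewrite exprn_gt0.
have p0 n : 0 < 2 ^+ n :> R by rewrite exprn_gt0.
have Tn0 n : 0 < T / 8 ^+ n by rewrite divr_gt0.
pose idx n (t : R) := Num.truncn (t * 8 ^+ n / T).
have tT_ge0 n t : 0 <= t -> 0 <= t * 8 ^+ n / T.
  by move=> t0; rewrite divr_ge0 ?mulr_ge0 // ltW.
have idxP n t : 0 <= t -> (idx n t)%:R <= t * 8 ^+ n / T < (idx n t).+1%:R.
  by move=> t0; apply: truncn_itv; exact: tT_ge0.
have idx_le n t : 0 <= t -> t <= T -> (idx n t <= 8 ^ n)%N.
  move=> t0 tT; have /andP[le1 _] := idxP n t t0.
  rewrite -(ler_nat R) natrX; apply: le_trans le1 _.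
  by rewrite ler_pdivrMr // mulrC ler_wpM2l // ltW.
have gridP n t : 0 <= t -> grid T n (idx n t) <= t < grid T n (idx n t) + T / 8 ^+ n.
  move=> t0; have /andP[] := idxP n t t0.
  rewrite ler_pdivlMr // ltr_pdivrMr // -[(idx n t).+1%:R]natr1 /grid => le1 lt1.
  apply/andP; split; first by rewrite ler_pdivrMr //; lra.
  by rewrite -mulrDl ltr_pdivlMr //; lra.
have idx_step n t : 0 <= t -> exists2 r, (r <= 7)%N & idx n.+1 t = (8 * idx n t + r)%N.
  move=> t0; have /andP[a1 a2] := idxP n t t0; have /andP[b1 b2] := idxP n.+1 t t0.
  have E8 : t * 8 ^+ n.+1 / T = 8 * (t * 8 ^+ n / T) by rewrite exprS; ring.
  rewrite E8 in b1 b2.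
  have c1 : (8 * idx n t < (idx n.+1 t).+1)%N.
    by rewrite -(ltr_nat R) natrM; apply: le_lt_trans b2; rewrite ler_pM2l.
  have c2 : (idx n.+1 t < 8 * (idx n t).+1)%N.
    by rewrite -(ltr_nat R) natrM; apply: le_lt_trans b1 _; rewrite ltr_pM2l.
  by exists (idx n.+1 t - 8 * idx n t)%N; move: c1 c2; lia.
have step n t : 0 <= t -> t <= T ->
    `|w (grid T n.+1 (idx n.+1 t)) - w (grid T n (idx n t))| <= 7 * (k / 2 ^+ n.+1).
  move=> t0 tT; have [r r7 E] := idx_step n t t0.
  rewrite E -(grid_scale T n); apply: (le_trans (grid_chain (r := r) (H n.+1) _)).
    by rewrite -E; exact: idx_le.
  by rewrite ler_wpM2r ?ler_nat // divr_ge0 // ltW.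
(* The partial geometric sum is written in closed form, so that the induction closes. *)
have chain n l t : 0 <= t -> t <= T ->
    `|w (grid T (n + l) (idx (n + l)%N t)) - w (grid T n (idx n t))|
      <= 7 * (k / 2 ^+ n) - 7 * (k / 2 ^+ (n + l)).
  move=> t0 tT; elim: l => [|l IH]; first by rewrite addn0 !subrr normr0.
  have := step (n + l)%N t t0 tT; rewrite addnS.
  have := ler_distD (w (grid T (n + l) (idx (n + l)%N t)))
    (w (grid T (n + l).+1 (idx (n + l).+1 t))) (w (grid T n (idx n t))).
  have E2 : k / 2 ^+ (n + l) = 2 * (k / 2 ^+ (n + l).+1) :> R.
    by rewrite exprS; field; rewrite gt_eqF.
  rewrite E2 in IH; lra.
have limit n t : 0 <= t -> t <= T -> `|w t - w (grid T n (idx n t))| <= 7 * (k / 2 ^+ n).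
  move=> t0 tT; apply/ler_addgt0Pr => e e_gt0.
  have /cvgrPdist_lt/(_ _ e_gt0)[d /= d0 Hd] := cw t.
  have [l Hl] : exists l, T / 8 ^+ (n + l) < d.
    exists (Num.truncn (T / d)); rewrite ltr_pdivrMr // mulrC -ltr_pdivrMr //.
    apply: lt_le_trans (truncnS_gt _) _; rewrite -natrX ler_nat.
    apply: leq_ltn_trans (leq_addl n _) _.
    exact: ltn_expl.
  have /andP[g1 g2] := gridP (n + l)%N t t0.
  have /Hd : `|t - grid T (n + l) (idx (n + l)%N t)| < d.
    by rewrite ger0_norm; lra.
  have := chain n l t t0 tT.
  have : 0 <= k / 2 ^+ (n + l) by rewrite divr_ge0 // ltW.
  have := ler_distD (w (grid T (n + l) (idx (n + l)%N t))) (w t) (w (grid T n (idx n t))).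
  lra.
have main n u v : 0 <= u -> u <= v -> v <= T -> v - u <= T / 8 ^+ n ->
    `|w v - w u| <= 15 * (k / 2 ^+ n).
  move=> u0 uv vT vu.
  have v0 := le_trans u0 uv; have uT := le_trans uv vT.
  have /andP[u1 u2] := idxP n u u0; have /andP[v1 v2] := idxP n v v0.
  have uv' : u * 8 ^+ n / T <= v * 8 ^+ n / T by rewrite ler_pM2r ?invr_gt0 // ler_pM2r.
  have vu' : v * 8 ^+ n / T <= u * 8 ^+ n / T + 1.
    rewrite -lerBlDl -mulrBl ler_pdivrMr // mul1r -mulrBl.
    by rewrite -ler_pdivlMr.
  have i1 : (idx n u < (idx n v).+1)%N.
    by rewrite -(ltr_nat R); lra.
  have i2 : (idx n v < (idx n u).+2)%N.
    by rewrite -(ltr_nat R) -[(idx n u).+2%:R]natr1; lra.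
  have Lu := limit n u u0 uT; have Lv := limit n v v0 vT.
  have kn0 : 0 <= k / 2 ^+ n by rewrite divr_ge0 // ltW.
  have mid : `|w (grid T n (idx n v)) - w (grid T n (idx n u))| <= k / 2 ^+ n.
    have [E|E] : idx n v = idx n u \/ idx n v = (idx n u).+1.
      by move: (idx n u) (idx n v) i1 i2 => i j ij ji; clear -ij ji; lia.
      by rewrite E subrr normr0.
    by rewrite E; apply: H; rewrite -E; exact: idx_le.
  have := ler_distD (w (grid T n (idx n v))) (w v) (w u).
  have := ler_distD (w (grid T n (idx n u))) (w (grid T n (idx n v))) (w u).
  rewrite (distrC (w u)) in Lu; lra.
move=> n u v u0 uT v0 vT uv; rewrite -mulrA.
have [le|lt] := leP u v.
  by rewrite distrC; apply: main => //; move: uv; rewrite distrC ger0_norm // subr_ge0.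
by apply: main => //; [exact: ltW | move: uv; rewrite ger0_norm // subr_ge0 ltW].
Qed.

(** Serves to choose the scale of the modulus: fine enough for [E] to gain less than [b], yet with
    [2 ^+ n] at most linear in [A]. *)
Lemma exp2_bracket {R : realType} (A : R) :
  0 <= A -> exists2 n : nat, A < 2 ^+ n & 2 ^+ n <= 2 * A + 1.
Proof.
move=> A0; have ex : exists n, A < 2 ^+ n.
  exists (Num.truncn A); apply: lt_le_trans (truncnS_gt _) _.
  by rewrite -natrX ler_nat; exact: ltn_expl.
case: (ex_minnP ex) => -[|n] An minn; first by exists 0%N => //; rewrite expr0; lra.
exists n.+1 => //; rewrite exprS leNgt; apply/negP => lt.
have : A < 2 ^+ n by lra.
by move/minn; rewrite ltnn.
Qed.

Ltac solve_ge0 :=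
  repeat first [done | by apply: ltW | apply: addr_ge0 | apply: divr_ge0
    | apply: mulr_ge0 | apply: exprn_ge0].

(** At the chosen scale [E] gains less than [b] over times up to [T / 8 ^+ n], so there are at most
    [8 ^+ n = O((1 + k)^3)] down phases and hits. Each down term is [O(1 + k)], which gives
    [O((1 + k)^4)] before squaring. *)
Lemma pairing_limit_bound {R : realType} (m b D0 D1 T F : R) (phi : R -> R) :
  0 < m -> 0 < b -> 0 < D0 -> 0 <= D1 -> 0 < T ->
  continuous phi -> (forall t, `|phi t| <= F) ->
  exists2 C, 0 <= C & forall k c w s K N tau,
    0 <= k -> modulus T k w -> 0 < c ->
    switching c b D1 T (fun t => m * t + D0 * w t) w s K ->
    hits (fun t => m * t + D0 * w t) b T N tau ->
    (\sum_(j < K./2) c * \int[lebesgue_measure]_(x in [set` down_itv T s j]) phi x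
      - b * \sum_(j < N) phi (tau j.+1)) ^+ 2 <= C * (1 + k ^+ 8).
Proof.
move=> m0 b0 D00 D10 T0 cphi HF.
have F0 : 0 <= F by apply: le_trans (HF 0).
(* [C1 (1 + k)] will bound [2 A + 1], hence [2 ^+ n]; [C2 (1 + k)] will bound one down term plus one
   limit term. The factor [2 ^+ 8] below comes from [(1 + k)^8 <= 2^8 (1 + k^8)]. *)
pose C1 := 2 * (m * T / b) + 1 + 30 * D0 / b.
pose C2 := F * (2 * b + 15 * D1).
have C1_0 : 0 <= C1 by rewrite /C1; solve_ge0.
have C2_0 : 0 <= C2 by rewrite /C2; solve_ge0.
exists ((C1 ^+ 3 * C2) ^+ 2 * 2 ^+ 8) => [|k c w s K N tau k0 mod c0 sw hh].
  by solve_ge0.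
set E := fun t => _ in sw hh *.
pose A := (m * T + 15 * D0 * k) / b.
have A0 : 0 <= A by rewrite /A; solve_ge0.
have [n An nA] := exp2_bracket A0.
have p0 : 0 < 2 ^+ n :> R by rewrite exprn_gt0.
have e0 : 0 < 8 ^+ n :> R by rewrite exprn_gt0.
(* Scale 0 of the modulus bounds the oscillation over all of [[0, T]]. *)
have HO u v : 0 <= u -> u <= T -> 0 <= v -> v <= T -> `|w u - w v| <= 15 * k.
  move=> u0 uT v0 vT; have := mod 0%N u v u0 uT v0 vT.
  by rewrite !expr0 !divr1; apply; rewrite ler_norml; apply/andP; split; lra.
pose h := T / 8 ^+ n.
have h0 : 0 < h by rewrite divr_gt0.
have osc u v : 0 <= u -> u <= v -> v <= T -> v - u <= h -> E v < E u + b.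
  move=> u0 uv vT vu; have v0 := le_trans u0 uv; have uT := le_trans uv vT.
  have wvu : w v - w u <= 15 * k / 2 ^+ n.
    apply: le_trans (ler_norm _) _; apply: mod => //.
    by rewrite ger0_norm ?subr_ge0.
  (* Relaxing [T / 8 ^+ n] to [T / 2 ^+ n] in the drift lets drift and noise add up to
     [A b / 2 ^+ n], which is below [b]. *)
  have le28 : 2 ^+ n <= 8 ^+ n :> R by apply: lerXn2r; rewrite ?nnegrE ?ler_nat.
  have h2 : h <= T / 2 ^+ n by rewrite ler_pM2l // lef_pV2.
  have : (m * T + 15 * D0 * k) / 2 ^+ n < b.
    by rewrite ltr_pdivrMr // [b * _]mulrC -ltr_pdivrMr.
  have -> : (m * T + 15 * D0 * k) / 2 ^+ n =
    m * (T / 2 ^+ n) + D0 * (15 * k / 2 ^+ n) by ring.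
  have : m * (v - u) <= m * (T / 2 ^+ n) by rewrite ler_pM2l //; exact: le_trans h2.
  have : D0 * (w v - w u) <= D0 * (15 * k / 2 ^+ n) by rewrite ler_pM2l.
  rewrite /E; lra.
have count_le (J : nat) : J%:R * h <= T -> J%:R <= (2 * A + 1) ^+ 3.
  rewrite /h mulrCA -ler_pdivlMl // mulVf ?gt_eqF // ler_pdivrMr // mul1r => J8.
  apply: le_trans J8 _; have -> : 8 ^+ n = (2 ^+ n) ^+ 3 :> R.
    by rewrite -exprM mulnC exprM; congr (_ ^+ _); rewrite -natrX.
  by rewrite lerXn2r ?nnegrE //; solve_ge0.
have JK := count_le _ (cycle_count (ltW h0) (ltW T0) osc sw).
have JN := count_le _ (hits_count (ltW h0) osc b0 hh).
set P := \sum_(j < K./2) _; set L := \sum_(j < N) _.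
have O0 : 0 <= 15 * k by rewrite mulr_ge0.
have HP : `|P| <= (2 * A + 1) ^+ 3 * (F * (b + D1 * (15 * k))).
  apply: le_trans (ler_norm_sum _ _ _) _.
  apply: (@le_trans _ _ (\sum_(j < K./2) F * (b + D1 * (15 * k)))).
    apply: ler_sum => j _; apply: (down_term_bound cphi HF c0 b0 D10 O0 HO sw).
    by have := ltn_ord j; rewrite geq_half_double doubleS.
  rewrite sumr_const card_ord -[X in X <= _]mulr_natl ler_wpM2r //.
  by solve_ge0.
have HL : `|b * L| <= (2 * A + 1) ^+ 3 * (F * b).
  rewrite normrM gtr0_norm // [F * b]mulrC mulrCA ler_pM2l //.
  apply: le_trans (ler_norm_sum _ _ _) _.
  apply: (@le_trans _ _ (\sum_(j < N) F)); first exact: ler_sum.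
  by rewrite sumr_const card_ord -[X in X <= _]mulr_natl ler_wpM2r.
have A1 : 2 * A + 1 <= C1 * (1 + k).
  have -> : 2 * A + 1 = 2 * (m * T / b) + 1 + 30 * D0 / b * k by rewrite /A; field; rewrite gt_eqF.
  have : 0 <= 2 * (m * T / b) + 1 by solve_ge0.
  have : 0 <= 30 * D0 / b by solve_ge0.
  rewrite /C1; nra.
have C2k : F * (b + D1 * (15 * k)) + F * b <= C2 * (1 + k).
  have -> : F * (b + D1 * (15 * k)) + F * b = F * (2 * b + 15 * D1 * k) by ring.
  rewrite /C2 -[leRHS]mulrA; apply: ler_wpM2l => //.
  have : 0 <= b * k by rewrite mulr_ge0 // ltW.
  lra.
have tot : `|P - b * L| <= C1 ^+ 3 * C2 * (1 + k) ^+ 4.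
  apply: le_trans (ler_normB _ _) _.
  apply: (@le_trans _ _ ((2 * A + 1) ^+ 3 * (C2 * (1 + k)))).
    apply: (@le_trans _ _ ((2 * A + 1) ^+ 3 * (F * (b + D1 * (15 * k)) + F * b))).
      by rewrite mulrDr lerD.
    by rewrite ler_wpM2l //; solve_ge0.
  have -> : C1 ^+ 3 * C2 * (1 + k) ^+ 4 = (C1 * (1 + k)) ^+ 3 * (C2 * (1 + k)) by ring.
  rewrite ler_wpM2r //; first by solve_ge0.
  by rewrite lerXn2r ?nnegrE //; solve_ge0.
have k8 : (1 + k) ^+ 8 <= 2 ^+ 8 * (1 + k ^+ 8).
  have kk : 0 <= k ^+ 8 by rewrite exprn_ge0.
  have [k1|k1] := leP k 1.
    apply: (@le_trans _ _ (2 ^+ 8)); last by rewrite ler_peMr ?exprn_ge0 // lerDl.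
    by rewrite lerXn2r ?nnegrE //; lra.
  apply: (@le_trans _ _ ((2 * k) ^+ 8)); first by rewrite lerXn2r ?nnegrE //; lra.
  by rewrite exprMn ler_wpM2l ?exprn_ge0 // lerDr.
rewrite -[X in X <= _]ger0_norm ?sqr_ge0 // normrX.
apply: (@le_trans _ _ ((C1 ^+ 3 * C2 * (1 + k) ^+ 4) ^+ 2)).
  by rewrite lerXn2r ?nnegrE //; solve_ge0.
have -> : (C1 ^+ 3 * C2 * (1 + k) ^+ 4) ^+ 2 = (C1 ^+ 3 * C2) ^+ 2 * (1 + k) ^+ 8 by ring.
rewrite -[leRHS]mulrA; apply: ler_wpM2l; last exact: k8.
by solve_ge0.
Qed.

(** * Moments of Brownian increments *)

(** Doubling the standard deviation absorbs the eighth power. A moment bound then reduces to the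
    total mass of the wider Gaussian, and no moment integral has to be computed. *)
Lemma normal_pdf_tail {R : realType} (s x : R) (k : nat) :
  0 < s -> k%:R * s <= `|x| ->
  (k.+1%:R * s) ^+ 8 * normal_pdf 0 s x <= 2 * 16 ^+ 8 * s ^+ 8 * normal_pdf 0 (2 * s) x.
Proof.
move=> s0 kx.
have s2 : 0 < 2 * s by rewrite mulr_gt0.
rewrite !normal_pdfE ?gt_eqF // /normal_fun !subr0.
have peakE : normal_peak s = 2 * normal_peak (2 * s).
  rewrite /normal_peak.
  have -> : (2 * s) ^+ 2 * pi *+ 2 = 2 ^+ 2 * (s ^+ 2 * pi *+ 2) :> R by ring.
  by rewrite sqrtrM ?sqr_ge0 // sqrtr_sqr ger0_norm // invfM mulrA divff // mul1r.
have p0 := normal_peak_ge0 (2 * s).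
rewrite peakE.
pose y := `|x| / s.
have y0 : 0 <= y by rewrite divr_ge0 // ltW.
have ky : k%:R <= y by rewrite ler_pdivlMr.
have x2 : x ^+ 2 = y ^+ 2 * s ^+ 2
  by rewrite /y expr_div_n real_normK ?num_real // divfK // expf_neq0 // gt_eqF.
have e1 : - x ^+ 2 / (s ^+ 2 *+ 2) = - (y ^+ 2 / 2).
  by rewrite x2 -mulr_natr; field; rewrite gt_eqF.
have e2 : - x ^+ 2 / ((2 * s) ^+ 2 *+ 2) = - (y ^+ 2 / 8).
  by rewrite x2 -mulr_natr; field; rewrite gt_eqF.
rewrite e1 e2.
(* [(1 + y)^8 <= (16 (1 + 3 y^2 / 64))^8 <= 16^8 exp (3 y^2 / 8)] *)
have main : k.+1%:R ^+ 8 * expR (- (y ^+ 2 / 2)) <= 16 ^+ 8 * expR (- (y ^+ 2 / 8)).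
  have -> : - (y ^+ 2 / 8) = - (y ^+ 2 / 2) + 8 * (3 * y ^+ 2 / 64) by field.
  rewrite expRD mulrCA mulrC ler_wpM2l ?expR_ge0 //.
  rewrite expRM_natl -exprMn.
  rewrite lerXn2r ?nnegrE ?ler0n ?mulr_ge0 ?expR_ge0 //.
  apply: (@le_trans _ _ (16 * (1 + 3 * y ^+ 2 / 64))); last by rewrite ler_pM2l // expR_ge1Dx.
  rewrite -natr1; have := sqr_ge0 (y - 1); nra.
rewrite exprMn [leLHS](_ : _ = 2 * s ^+ 8 * normal_peak (2 * s) *
  (k.+1%:R ^+ 8 * expR (- (y ^+ 2 / 2)))); last by ring.
rewrite [leRHS](_ : _ = 2 * s ^+ 8 * normal_peak (2 * s) *
  (16 ^+ 8 * expR (- (y ^+ 2 / 8)))); last by ring.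
by rewrite ler_wpM2l // mulr_ge0 // mulr_ge0 // exprn_ge0 // ltW.
Qed.

Lemma normal_shell_bound {R : realType} (s : R) (k : nat) (B : set R) :
  0 < s -> measurable B -> (forall x, B x -> k%:R * s <= `|x|) ->
  (((k.+1%:R * s) ^+ 8)%:E * normal_prob 0 s B <=
   (2 * 16 ^+ 8 * s ^+ 8)%:E * normal_prob 0 (2 * s) B)%E.
Proof.
move=> s0 mB HB; rewrite /normal_prob.
have mpdf s' : measurable_fun B (EFin \o normal_pdf 0 s').
  by apply/measurable_EFinP; apply: measurable_funTS; exact: measurable_normal_pdf.
rewrite -!ge0_integralZl //.
- apply: ge0_le_integral => //.
  + by move=> x _; rewrite -EFinM lee_fin mulr_ge0 ?normal_pdf_ge0 // exprn_ge0 // mulr_ge0 // ltW.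
  + by apply: measurable_funeM; exact: mpdf.
  + by apply: measurable_funeM; exact: mpdf.
  + by move=> x /HB kx; rewrite -!EFinM lee_fin normal_pdf_tail.
- exact: mpdf.
- by move=> x _; rewrite lee_fin normal_pdf_ge0.
- by rewrite lee_fin mulr_ge0 // exprn_ge0 // ltW.
- exact: mpdf.
- by move=> x _; rewrite lee_fin normal_pdf_ge0.
- by rewrite lee_fin exprn_ge0 // mulr_ge0 // ltW.
Qed.

(** Cut according to the shells [k s <= |X| < (k + 1) s], bound [X^8] by its outer value on each,
    and sum the shell bounds: the wider Gaussian law gives the disjoint shells total mass at most
    1. *)
Lemma normal_moment8 {R : realType} d (Omega : measurableType d)
    (P : probability Omega R) (X : Omega -> R) (s : R) :
  0 < s -> measurable_fun setT X ->
  (forall B : set R, measurable B -> P (X @^-1` B) = normal_prob 0 s B) ->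
  (\int[P]_w (X w ^+ 8)%:E <= (2 * 16 ^+ 8 * s ^+ 8)%:E)%E.
Proof.
move=> s0 mX law.
pose B k := [set x : R | k%:R * s <= `|x| < k.+1%:R * s].
have mB k : measurable (B k).
  rewrite (_ : B k = (@Num.norm R R) @^-1` [set` `[k%:R * s, k.+1%:R * s[]); last first.
    by apply/seteqP; split => x /=; rewrite /B /= in_itv.
  by rewrite -[X in measurable X]setTI; apply: normr_measurable => //; exact: measurable_itv.
pose F k := X @^-1` B k.
have mF k : measurable (F k) by rewrite -[F k]setTI; exact: mX.
have tB : trivIset setT B.
  apply/trivIsetP => i j _ _; wlog ij : i j / (i < j)%N => [H|] ne.
    by have := ne; rewrite neq_ltn => /orP[]ij; [|rewrite setIC]; apply: H => //; rewrite eq_sym.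
  rewrite -subset0 => x [/= /andP[_ xi] /andP[jx _]].
  have : i.+1%:R * s <= j%:R * s by rewrite ler_pM2r // ler_nat.
  lra.
have tF : trivIset setT F.
  apply/trivIsetP => i j _ _ ij; rewrite -preimage_setI.
  by move/trivIsetP: tB => /(_ i j I I ij) ->; rewrite preimage_set0.
have FT : \bigcup_k F k = setT.
  apply/seteqP; split => // w _.
  exists (Num.truncn (`|X w| / s)) => //; rewrite /F /B /=.
  have : 0 <= `|X w| / s by rewrite divr_ge0 // ltW.
  by move=> /truncn_itv; rewrite ler_pdivlMr // ltr_pdivrMr.
have mX8 : measurable_fun setT (fun w => (X w ^+ 8)%:E).
  by apply/measurable_EFinP; exact: measurable_funX.
have X8 w : (0 <= (X w ^+ 8)%:E)%E by rewrite lee_fin -[8%N]/(2 * 4)%N exprM exprn_ge0 // sqr_ge0.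
rewrite -{1}FT ge0_integral_bigcup //; last first.
  by rewrite FT.
apply: (@le_trans _ _ (\big[+%E/0%E]_(0 <= k <oo)
    ((2 * 16 ^+ 8 * s ^+ 8)%:E * normal_prob 0 (2 * s) (B k)))%E).
  apply: lee_nneseries => [k _ _|k _].
    by apply: integral_ge0 => w _; exact: X8.
  have Bk x : B k x -> k%:R * s <= `|x| by move=> /andP[].
  apply: le_trans (normal_shell_bound s0 (mB k) Bk).
  rewrite -law // -(integral_cst P (mF k)).
  apply: ge0_le_integral => //.
  + exact: measurable_funTS.
  + move=> w /andP[_ /ltW lt]; rewrite lee_fin.
    rewrite -[8%N]/(2 * 4)%N 2!exprM -(real_normK (num_real (X w))) -!exprM.
    by rewrite lerXn2r ?nnegrE // mulr_ge0 // ltW.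
rewrite nneseriesZl; last by move=> k _; exact: (measure_ge0 (normal_prob 0 (2 * s))).
rewrite -[leRHS]mule1 lee_wpmul2l //.
  by rewrite lee_fin mulr_ge0 // exprn_ge0 // ltW.
rewrite -(@measure_semi_bigcup _ _ _ (normal_prob 0 (2 * s))) //.
  by apply: probability_le1; exact: bigcupT_measurable.
exact: bigcupT_measurable.
Qed.

Lemma standard_BM_increment {R : realType} d (Omega : measurableType d)
    (P : probability Omega R) (W : R -> Omega -> R) (s t : R) :
  standard_BM P W -> 0 <= s -> s < t -> forall B : set R, measurable B ->
  P ((fun w => W t w - W s w) @^-1` B) = normal_prob 0 (Num.sqrt (t - s)) B.
Proof.
move=> [_ _ _ H] s0 st B mB.
have := H 1%N (fun i => if i is 0%N then s else t) (fun=> B) s0 _ (fun _ _ => mB).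
rewrite big_ord1 /= => <-; last by case.
congr (P _); apply/seteqP; split => w /=.
  by move=> Bw; case=> //= _; rewrite inE.
by move=> /(_ 0%N erefl) /=; rewrite inE.
Qed.

(* Freezing the path at negative times makes it continuous on the whole line. *)
Definition nonneg_path {R : realType} {Omega : Type} (W : R -> Omega -> R) (w : Omega)
    (t : R) : R :=
  W (Num.max 0 t) w.

Lemma nonneg_path_continuous {R : realType} d (Omega : measurableType d)
    (P : probability Omega R) (W : R -> Omega -> R) (w : Omega) :
  standard_BM P W -> continuous (nonneg_path W w).
Proof.
move=> [_ /(_ w) cW _ _] t.
have m0 s : `[0, +oo[%classic (Num.max 0 s : R) by rewrite /= in_itv /= andbT le_max lexx.
have maxc : Num.max 0 s @[s --> t] --> Num.max 0 t.
  exact: (@continuous_max R R (cst 0) id t (@cst_continuous _ _ _ _) (@cvg_id _ _)).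
move/subspace_continuousP : cW => /(_ _ (m0 t)) cW.
apply: cvg_trans cW => U HU.
have {}HU : nbhs (Num.max 0 t) (fun y => `[0, +oo[%classic y -> U (W y w)) by [].
have {}HU : \forall s \near t, `[0, +oo[%classic (Num.max 0 s) -> U (W (Num.max 0 s) w).
  exact: maxc HU.
by apply: filterS HU => s; apply; exact: m0.
Qed.

(** * The random Hoelder constant *)

Lemma measurable_grid_sum {R : realType} d (Omega : measurableType d)
    (P : probability Omega R) (W : R -> Omega -> R) (T : R) n :
  standard_BM P W -> measurable_fun setT
    (fun w => \sum_(i < 8 ^ n) (2 ^+ n * (W (grid T n i.+1) w - W (grid T n i) w)) ^+ 8).
Proof.
move=> [_ _ mW _]; apply: measurable_sum => i.
apply: measurable_funX; apply: measurable_funM => //.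
by apply: measurable_funB; exact: mW.
Qed.

(* The 8-th power of a 1/3-Hoelder constant; the expectation of the [n]-th term is
   [8^n 2^(8 n) O(8^(- 4 n)) = O(2^(- n))]. *)
Definition holder_const {R : realType} {Omega : Type} (W : R -> Omega -> R) (T : R)
    (w : Omega) : \bar R :=
  (\big[+%E/0%E]_(0 <= n <oo)
    (\sum_(i < 8 ^ n) (2 ^+ n * (W (grid T n i.+1) w - W (grid T n i) w)) ^+ 8)%:E)%E.

Lemma geometric_nneseries {R : realType} (C : R) (f : nat -> \bar R) :
  0 <= C -> (forall n, (0 <= f n)%E) -> (forall n, (f n <= (C / 2 ^+ n)%:E)%E) ->
  (\big[+%E/0%E]_(0 <= n <oo) f n <= (2 * C)%:E)%E.
Proof.
move=> C0 f0 fC; apply: lime_le; first exact: is_cvg_nneseries.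
apply: nearW => n; apply: (@le_trans _ _ (\sum_(0 <= i < n) (C / 2 ^+ i)%:E)%E).
  exact: lee_sum.
rewrite sumEFin lee_fin.
suff -> : \sum_(0 <= i < n) C / 2 ^+ i = 2 * C - 2 * C / 2 ^+ n.
  by rewrite gerBl divr_ge0 ?mulr_ge0 ?exprn_ge0.
elim: n => [|n IH]; first by rewrite big_nil expr0 divr1 subrr.
by rewrite big_nat_recr //= IH exprS; field; rewrite expf_neq0.
Qed.

Lemma exp8_ge0 {R : realType} (x : R) : 0 <= x ^+ 8.
Proof. by rewrite -[8%N]/(2 * 4)%N exprM exprn_ge0 // sqr_ge0. Qed.

Lemma holder_const_integrable {R : realType} d (Omega : measurableType d)
    (P : probability Omega R) (W : R -> Omega -> R) (T : R) :
  0 < T -> standard_BM P W -> P.-integrable setT (holder_const W T).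
Proof.
move=> T0 BM.
have e0 n : 0 < 8 ^+ n :> R by rewrite exprn_gt0.
have S0 n w : 0 <= \sum_(i < 8 ^ n)
    (2 ^+ n * (W (grid T n i.+1) w - W (grid T n i) w)) ^+ 8.
  by apply: sumr_ge0 => i _; exact: exp8_ge0.
have mS n := measurable_grid_sum T n BM.
have hc0 w : (0 <= holder_const W T w)%E.
  by apply: nneseries_ge0 => n _ _; rewrite lee_fin.
apply/integrableP; split.
  apply: (ge0_emeasurable_sum (P := xpredT)) => [n w _ _|n _]; first by rewrite lee_fin.
  by apply/measurable_EFinP.
rewrite (eq_integral (holder_const W T)); last by move=> w _; rewrite gee0_abs.
rewrite /holder_const integral_nneseries //; last 2 first.
- by move=> n; apply/measurable_EFinP.
- by move=> n w _; rewrite lee_fin.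
pose C : R := 2 * 16 ^+ 8 * T ^+ 4.
apply: (@le_lt_trans _ _ (2 * C)%:E); last exact: ltry.
apply: geometric_nneseries.
- by rewrite !mulr_ge0 ?exprn_ge0 // ltW.
- by move=> n; apply: integral_ge0 => w _; rewrite lee_fin.
move=> n; under eq_integral do rewrite -sumEFin.
rewrite ge0_integral_sum //; last 2 first.
- move=> i; apply/measurable_EFinP; apply: measurable_funX; apply: measurable_funM => //.
  by case: BM => _ _ mW _; apply: measurable_funB; exact: mW.
- by move=> i w _; rewrite lee_fin exp8_ge0.
(* With [8 ^+ n = (2 ^+ n) ^+ 3], the factor [2^(8 n)] times the moment [O(2^(- 12 n))] is
   [O(2^(- 4 n))], that is [1 / 8 ^+ n] to cancel the number of increments and [1 / 2 ^+ n] to sum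
   over [n]. *)
have one (i : nat) : (\int[P]_w ((2 ^+ n * (W (grid T n i.+1) w - W (grid T n i) w)) ^+ 8)%:E
    <= (C / 2 ^+ n / 8 ^+ n)%:E)%E.
  have mD : measurable_fun setT (fun w => W (grid T n i.+1) w - W (grid T n i) w).
    by case: BM => _ _ mW _; apply: measurable_funB; exact: mW.
  have gT : grid T n i.+1 - grid T n i = T / 8 ^+ n.
    by rewrite /grid -[i.+1%:R]natr1; field; rewrite gt_eqF.
  have gi : grid T n i < grid T n i.+1 by rewrite -subr_gt0 gT divr_gt0.
  have g0 : 0 <= grid T n i by rewrite divr_ge0 ?mulr_ge0 // ltW.
  have s0 : 0 < Num.sqrt (grid T n i.+1 - grid T n i) by rewrite sqrtr_gt0 subr_gt0.
  have := normal_moment8 s0 mD (standard_BM_increment BM g0 gi).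
  have -> : Num.sqrt (grid T n i.+1 - grid T n i) ^+ 8 = T ^+ 4 / (8 ^+ n) ^+ 4.
    by rewrite -[8%N in LHS]/(2 * 4)%N exprM sqr_sqrtr ?gT ?expr_div_n // ltW // divr_gt0.
  move=> mom.
  under eq_integral do rewrite exprMn EFinM.
  have mD8 : measurable_fun setT
      (fun w => ((W (grid T n i.+1) w - W (grid T n i) w) ^+ 8)%:E).
    by apply/measurable_EFinP; exact: measurable_funX.
  have D8 w : [set: Omega] w ->
      (0 <= ((W (grid T n i.+1) w - W (grid T n i) w) ^+ 8)%:E)%E.
    by rewrite lee_fin exp8_ge0.
  have c8 : 0 <= (2 ^+ n) ^+ 8 :> R by exact: exp8_ge0.
  rewrite (ge0_integralZl P measurableT mD8 D8) ?lee_fin //.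
  apply: (@le_trans _ _ (((2 ^+ n) ^+ 8)%:E *
      (2 * 16 ^+ 8 * (T ^+ 4 / (8 ^+ n) ^+ 4))%:E)%E).
    by rewrite lee_wpmul2l // lee_fin exp8_ge0.
  rewrite -EFinM lee_fin le_eqVlt; apply/orP; left; apply/eqP.
  have -> : 8 ^+ n = (2 ^+ n) ^+ 3 :> R.
    by rewrite -exprM mulnC exprM; congr (_ ^+ _); rewrite -natrX.
  by rewrite /C; field; rewrite expf_neq0.
apply: (@le_trans _ _ (\sum_(i < 8 ^ n) (C / 2 ^+ n / 8 ^+ n)%:E)%E).
  by apply: lee_sum => i _; exact: one.
rewrite sumEFin lee_fin sumr_const card_ord -[X in X <= _]mulr_natr natrX divfK //.
Qed.

(** A single term of the series is at most its sum, which bounds each rescaled grid increment by the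
    eighth root [k], obtained as three nested square roots. *)
Lemma holder_const_modulus {R : realType} d (Omega : measurableType d)
    (P : probability Omega R) (W : R -> Omega -> R) (T : R) (w : Omega) :
  0 < T -> standard_BM P W -> holder_const W T w \is a fin_num ->
  exists k, [/\ 0 <= k, k ^+ 8 = fine (holder_const W T w) & modulus T k (nonneg_path W w)].
Proof.
move=> T0 BM fin.
set v := fine _.
have vE : holder_const W T w = v%:E by rewrite fineK.
have v0 : 0 <= v.
  rewrite -lee_fin -vE; apply: nneseries_ge0 => n _ _.
  by rewrite lee_fin; apply: sumr_ge0 => i _; exact: exp8_ge0.
pose k := Num.sqrt (Num.sqrt (Num.sqrt v)).
have k8 : k ^+ 8 = v.
  by rewrite -[8%N]/(2 * 2 * 2)%N !exprM !sqr_sqrtr ?sqrtr_ge0.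
have k0 : 0 <= k by exact: sqrtr_ge0.
exists k; split => //.
apply: grid_modulus => //; first exact: nonneg_path_continuous BM.
move=> n i i8.
have p0 : 0 < 2 ^+ n :> R by rewrite exprn_gt0.
have g0 j : 0 <= grid T n j by rewrite divr_ge0 ?mulr_ge0 ?exprn_ge0 // ltW.
rewrite /nonneg_path !max_r // ler_pdivlMr // mulrC -[X in X * _](gtr0_norm p0) -normrM.
rewrite -(@ler_pXn2r _ 8) ?nnegrE // k8.
have -> : `|2 ^+ n * (W (grid T n i.+1) w - W (grid T n i) w)| ^+ 8 =
    (2 ^+ n * (W (grid T n i.+1) w - W (grid T n i) w)) ^+ 8.
  by rewrite -normrX ger0_norm // exp8_ge0.
rewrite -lee_fin -vE /holder_const.
pose f n := (\sum_(i < 8 ^ n) (2 ^+ n * (W (grid T n i.+1) w - W (grid T n i) w)) ^+ 8)%:E.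
apply: (@le_trans _ _ (f n)).
  rewrite /f lee_fin (bigD1 (Ordinal i8)) //= lerDl.
  by apply: sumr_ge0 => j _; exact: exp8_ge0.
have f0 j : (0 <= f j)%E.
  by rewrite lee_fin; apply: sumr_ge0 => l _; exact: exp8_ge0.
apply: (@le_trans _ _ (\sum_(0 <= j < n.+1) f j)%E).
  by rewrite big_nat_recr //= leeDr // sume_ge0.
exact: nneseries_lim_ge.
Qed.

Lemma affine_continuous {R : realType} (m D0 : R) (f : R -> R) :
  continuous f -> continuous (fun t => m * t + D0 * f t).
Proof.
move=> cf s.
have cm : m * t @[t --> s] --> m * s by apply: cvgMr; exact: cvg_id.
have cd : D0 * f t @[t --> s] --> D0 * f s by apply: cvgMr; exact: cf.
exact: cvgD cm cd.
Qed.

(** * The maximum of a drifted Brownian motion has no atom *)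

Definition dyad {R : realType} (h q : R) (n i : nat) : R := h + (q - h) * i%:R / 2 ^+ n.

Lemma dyad_scale {R : realType} (h q : R) (n i : nat) :
  dyad h q n.+1 (2 * i) = dyad h q n i.
Proof. by rewrite /dyad natrM exprS; field. Qed.

Lemma dyad_bounds {R : realType} (h q : R) (n i : nat) :
  h <= q -> (i <= 2 ^ n)%N -> h <= dyad h q n i <= q.
Proof.
move=> hq iN; have p0 : 0 < 2 ^+ n :> R by rewrite exprn_gt0.
have qh : 0 <= q - h by rewrite subr_ge0.
apply/andP; split; first by rewrite lerDl divr_ge0 ?mulr_ge0 // ltW.
rewrite -lerBrDl ler_pdivrMr // ler_wpM2l //.
by rewrite -natrX ler_nat.
Qed.

Lemma dyad_dense {R : realType} (h q t d : R) :
  h < q -> h <= t -> t <= q -> 0 < d ->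
  exists n i, (i <= 2 ^ n)%N /\ `|dyad h q n i - t| < d.
Proof.
move=> hq ht tq d0; have qh : 0 < q - h by rewrite subr_gt0.
pose n := Num.truncn ((q - h) / d).
have p0 : 0 < 2 ^+ n :> R by rewrite exprn_gt0.
have small : (q - h) / 2 ^+ n < d.
  rewrite ltr_pdivrMr // mulrC -ltr_pdivrMr //.
  apply: lt_le_trans (truncnS_gt _) _.
  by rewrite -natrX ler_nat; exact: ltn_expl.
pose y := (t - h) * 2 ^+ n / (q - h).
have y0 : 0 <= y by rewrite divr_ge0 ?mulr_ge0 ?subr_ge0 // ltW.
have /andP[iy yi] := truncn_itv y0.
exists n, (Num.truncn y); split.
  rewrite -(ler_nat R) natrX; apply: le_trans iy _.
  by rewrite /y ler_pdivrMr // mulrC ler_pM2l // lerB.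
have tE : t = h + (q - h) * y / 2 ^+ n.
  by rewrite /y; field; rewrite !gt_eqF.
have -> : dyad h q n (Num.truncn y) - t =
    - ((q - h) / 2 ^+ n * (y - (Num.truncn y)%:R)).
  by rewrite {1}tE /dyad; ring.
rewrite normrN ger0_norm; last first.
  by rewrite mulr_ge0 ?subr_ge0 // divr_ge0 // ltW.
apply: le_lt_trans small.
rewrite ler_piMr ?divr_ge0 // ?ltW //.
by move: yi; rewrite -natr1; lra.
Qed.

Definition drifted {R : realType} {Omega : Type} (m D0 : R) (W : R -> Omega -> R)
    (t : R) (w : Omega) : R := m * t + D0 * W t w.

Definition dyad_below {R : realType} {Omega : Type} (E : R -> Omega -> R) (h q c : R)
    (n : nat) : set Omega :=
  [set w | forall i, (i <= 2 ^ n)%N -> E (dyad h q n i) w - E h w <= c].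

(* For a continuous path this is the event that the maximum of [E - E h] over [[h, q]] is at
   most [c]. *)
Definition dyads_below {R : realType} {Omega : Type} (E : R -> Omega -> R) (h q c : R) :
  set Omega := \bigcap_n dyad_below E h q c n.

(** Measurability is needed for the sigma-algebra generated by the increments after [h], the one on
    which independence from [W h] is proved: [E - E h] at a grid point is a drift plus [D0] times a
    sum of such increments. *)
Lemma dyad_below_measurable_gen {R : realType} (Omega : pointedType)
    (G : set (set Omega)) (m D0 : R) (W : R -> Omega -> R) (h q c : R) n :
  (forall i, (i < 2 ^ n)%N -> forall B : set R, measurable B ->
     G ((fun w => W (dyad h q n i.+1) w - W (dyad h q n i) w) @^-1` B)) ->
  <<s G >> (dyad_below (drifted m D0 W) h q c n).
Proof.
move=> GZ.
pose Z i (w : g_sigma_algebraType G) := W (dyad h q n i.+1) w - W (dyad h q n i) w.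
have mZ i : (i < 2 ^ n)%N -> measurable_fun setT (Z i).
  move=> i2 _ B mB; rewrite setTI; apply: sub_sigma_algebra; exact: GZ.
have d0 : dyad h q n 0 = h by rewrite /dyad mulr0 mul0r addr0.
have telescope i (w : Omega) : drifted m D0 W (dyad h q n i) w - drifted m D0 W h w =
    m * (dyad h q n i - h) + D0 * \sum_(l < i) Z l w.
  elim: i => [|i IH]; first by rewrite big_ord0 d0 mulr0 !subrr mulr0 addr0.
  rewrite big_ord_recr /= mulrDr; move: IH; rewrite /drifted /Z.
  by move: (\sum_(_ < _) _) => S; lra.
have mE i : (i <= 2 ^ n)%N -> measurable_fun setT
    (fun w : g_sigma_algebraType G => m * (dyad h q n i - h) + D0 * \sum_(l < i) Z l w).
  move=> i2; apply: measurable_funD => //; apply: measurable_funM => //.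
  apply: measurable_sum => l; apply: mZ; exact: leq_trans (ltn_ord l) i2.
have -> : dyad_below (drifted m D0 W) h q c n = \bigcap_(i in [set i | (i <= 2 ^ n)%N])
    ((fun w : g_sigma_algebraType G =>
        m * (dyad h q n i - h) + D0 * \sum_(l < i) Z l w) @^-1` [set` `]-oo, c]]).
  by apply/seteqP; split => w H i i2; move: (H i i2); rewrite telescope /= in_itv.
suff : measurable (\bigcap_(i in [set i | (i <= 2 ^ n)%N])
    ((fun w : g_sigma_algebraType G =>
        m * (dyad h q n i - h) + D0 * \sum_(l < i) Z l w) @^-1` [set` `]-oo, c]])) by [].
apply: bigcap_measurable => [|i i2]; first by exists 0%N.
by rewrite -[X in measurable X]setTI; apply: mE => //; exact: measurable_itv.
Qed.

Lemma dyad_below_indep {R : realType} d (Omega : measurableType d)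
    (P : probability Omega R) (W : R -> Omega -> R) (m D0 h q c : R) n (A : set R) :
  standard_BM P W -> 0 < h -> h < q -> measurable A ->
  P (dyad_below (drifted m D0 W) h q c n `&` W h @^-1` A) =
  (P (W h @^-1` A) * P (dyad_below (drifted m D0 W) h q c n))%E.
Proof.
move=> BM h0 hq mA.
have [W0 _ mW HBM] := BM.
pose Z i w := W (dyad h q n i.+1) w - W (dyad h q n i) w.
(* Independence extends from the increments to the generated sigma-algebra, because the
   events [rect B] form a pi-system. *)
pose rect (B : nat -> set R) : set Omega :=
  \bigcap_(i in [set i | (i < 2 ^ n)%N]) Z i @^-1` B i.
pose G := [set S | exists2 B : nat -> set R, (forall i, measurable (B i)) & S = rect B].
have mWA (B : set R) : measurable B -> measurable (W h @^-1` B).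
  by move=> mB; rewrite -[X in measurable X]setTI; exact: mW.
have mZ i (B : set R) : measurable B -> measurable (Z i @^-1` B).
  by move=> mB; rewrite -[X in measurable X]setTI; apply: measurable_funB => //; exact: mW.
have mrect B : (forall i, measurable (B i)) -> measurable (rect B).
  move=> mB; apply: bigcap_measurable => [|i _]; last exact: mZ.
  by exists 0%N => /=; rewrite expn_gt0.
have GZ i : (i < 2 ^ n)%N -> forall B : set R, measurable B -> G (Z i @^-1` B).
  move=> i2 B mB; exists (fun j => if j == i then B else setT).
    by move=> j; case: ifP.
  apply/seteqP; split => w /=; last by move=> /(_ i i2); rewrite /= eqxx.
  by move=> Bw j _ /=; case: eqP => [->|].
have dlt i : dyad h q n i < dyad h q n i.+1.
  rewrite /dyad ltrD2l ltr_pM2r ?invr_gt0 ?exprn_gt0 // ltr_pM2l ?subr_gt0 //.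
  by rewrite ltr_nat.
have d0 : dyad h q n 0 = h by rewrite /dyad mulr0 mul0r addr0.
have law (C : set R) B : measurable C -> (forall i, measurable (B i)) ->
    P (rect B `&` W h @^-1` C) = (normal_prob 0 (Num.sqrt h) C *
      \big[*%E/1%E]_(i < 2 ^ n) normal_prob 0
        (Num.sqrt (dyad h q n i.+1 - dyad h q n i)) (B i))%E.
  move=> mC mB.
  (* Time 0 is put in front of the grid, so that [W h] is itself the first of the independent
     increments. *)
  pose t i := if i is j.+1 then dyad h q n j else 0.
  pose B' i := if i is j.+1 then B j else C.
  have := HBM (2 ^ n).+1 t B' (lexx _).
  rewrite big_ord_recl /= d0 subr0 => <-.
  - congr (P _); apply/seteqP; split => w /=.
      move=> [Bw Cw] [|i] i2; apply/mem_set; last exact: Bw.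
      by rewrite /= d0 W0 subr0.
    move=> H; split.
      by move=> i i2; exact: (set_mem (H i.+1 i2)).
    by have /set_mem := H 0%N isT; rewrite /= d0 W0 subr0.
  - by move=> [|i] _ /=; [rewrite d0 | exact: dlt].
  - by move=> [|i] _ /=; [exact: mC | exact: mB].
have PW (C : set R) : measurable C -> P (W h @^-1` C) = normal_prob 0 (Num.sqrt h) C.
  move=> mC; rewrite -[in RHS](subr0 h) -(standard_BM_increment BM (lexx 0) h0 mC).
  by congr (P _); apply/seteqP; split => w /=; rewrite W0 subr0.
have PA0 : (0 <= fine (P (W h @^-1` A)))%R by rewrite fine_ge0.
have PAfin : P (W h @^-1` A) \is a fin_num by rewrite fin_num_measure //; exact: mWA.
have cE : ((NngNum PA0)%:num)%:E = P (W h @^-1` A) by exact: fineK.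
(* Both sides are finite measures in [S], namely a restriction of [P] and a multiple of [P];
   agreement on the pi-system extends to the generated sigma-algebra. *)
have key : forall S, <<s G >> S ->
    P (S `&` W h @^-1` A) = ((NngNum PA0)%:num%:E * P S)%E.
  apply: (@g_sigma_algebra_measure_unique _ _ _ G _ (fun=> setT) _ _
    (mrestr P (mWA _ mA)) (mscale (NngNum PA0) P)) => //.
  - by move=> S [B mB ->]; exact: mrect.
  - move=> _; exists (fun=> setT) => //.
    by apply/seteqP; split.
  - by rewrite bigcup_const //; exists 0%N.
  - move=> _ _ [B mB ->] [C mC ->]; exists (fun i => B i `&` C i).
      by move=> i; exact: measurableI.
    apply/seteqP; split => w /=; first by move=> [Bw Cw] i i2; split; [exact: Bw | exact: Cw].
    by move=> H; split => i i2; case: (H i i2).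
  - move=> _ [B mB ->]; change (P (rect B `&` W h @^-1` A) = ((NngNum PA0)%:num%:E * P (rect B))%E).
    rewrite cE law // PW //.
    have := law setT B measurableT mB; rewrite preimage_setT setIT => ->.
    by rewrite probability_setT mul1e.
  - move=> k; change (P (setT `&` W h @^-1` A) < +oo)%E; rewrite setTI.
    apply: le_lt_trans (probability_le1 _ _) _ => //.
      exact: mWA.
    exact: ltry.
have := key _ (@dyad_below_measurable_gen R Omega G m D0 W h q c n GZ).
by rewrite cE.
Qed.

Lemma dyad_below_measurable {R : realType} d (Omega : measurableType d)
    (m D0 : R) (W : R -> Omega -> R) (h q c : R) n :
  (forall t, measurable_fun setT (W t)) ->
  measurable (dyad_below (drifted m D0 W) h q c n).
Proof.
move=> mW.
have mE t : measurable_fun setT (drifted m D0 W t).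
  by apply: measurable_funD => //; apply: measurable_funM.
have -> : dyad_below (drifted m D0 W) h q c n = \bigcap_(i in [set i | (i <= 2 ^ n)%N])
    ((fun w => drifted m D0 W (dyad h q n i) w - drifted m D0 W h w)
      @^-1` [set` `]-oo, c]]).
  by apply/seteqP; split => w H i i2; move: (H i i2); rewrite /= in_itv.
apply: bigcap_measurable => [|i i2]; first by exists 0%N.
by rewrite -[X in measurable X]setTI; apply: measurable_funB => //; exact: measurable_itv.
Qed.

Lemma dyads_below_measurable {R : realType} d (Omega : measurableType d)
    (m D0 : R) (W : R -> Omega -> R) (h q c : R) :
  (forall t, measurable_fun setT (W t)) ->
  measurable (dyads_below (drifted m D0 W) h q c).
Proof. by move=> mW; apply: bigcapT_measurable => n; exact: dyad_below_measurable. Qed.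

(** Continuity from above: the events [dyad_below] decrease because each dyadic grid refines the
    previous one. *)
Lemma dyads_below_indep {R : realType} d (Omega : measurableType d)
    (P : probability Omega R) (W : R -> Omega -> R) (m D0 h q c : R) (A : set R) :
  standard_BM P W -> 0 < h -> h < q -> measurable A ->
  P (dyads_below (drifted m D0 W) h q c `&` W h @^-1` A) =
  (P (W h @^-1` A) * P (dyads_below (drifted m D0 W) h q c))%E.
Proof.
move=> BM h0 hq mA; have [_ _ mW _] := BM.
set F := dyad_below (drifted m D0 W) h q c.
have mF n : measurable (F n) by exact: dyad_below_measurable.
have mWA : measurable (W h @^-1` A) by rewrite -[X in measurable X]setTI; exact: mW.
have FS n : F n.+1 `<=` F n.
  move=> w H i i2; rewrite -dyad_scale; apply: H.
  by rewrite expnS leq_mul2l.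
have ni : nonincreasing_seq F by apply/nonincreasing_seqP => n; exact/subsetPset.
have c1 : P (F n) @[n --> \oo] --> P (\bigcap_n F n).
  apply: (nonincreasing_cvg_mu (F := F)) => //.
  - by apply: le_lt_trans (probability_le1 _ _) _ => //; exact: ltry.
  - exact: bigcapT_measurable.
have c2 : P (F n `&` W h @^-1` A) @[n --> \oo] --> P (\bigcap_n (F n `&` W h @^-1` A)).
  apply: (nonincreasing_cvg_mu (F := fun n => F n `&` W h @^-1` A)).
  - apply: le_lt_trans (probability_le1 _ _) _; last exact: ltry.
    exact: measurableI.
  - by move=> n; exact: measurableI.
  - by apply: bigcapT_measurable => n; exact: measurableI.
  - by apply/nonincreasing_seqP => n; apply/subsetPset; apply: setSI; exact: FS.
rewrite /dyads_below -/F -bigcapIl; last by exists 0%N.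
apply: (cvg_unique _ c2); first exact: ereal_hausdorff.
rewrite (_ : (fun n => P (F n `&` W h @^-1` A)) = fun n => (P (W h @^-1` A) * P (F n))%E).
  apply: cvgeZl => //; exact: fin_num_measure.
by apply/funext => n; exact: dyad_below_indep.
Qed.

Lemma dyads_below_mono {R : realType} {Omega : Type} (E : R -> Omega -> R) (h q c c' : R) :
  c <= c' -> dyads_below E h q c `<=` dyads_below E h q c'.
Proof. by move=> cc w H n _ i i2; apply: le_trans cc; exact: H. Qed.

(** The set itself may fail to be measurable; intersecting measurable covers of probability at most
    [1 / (n + 1)] yields a null cover. *)
Lemma negligible_of_small {R : realType} d (Omega : measurableType d)
    (P : probability Omega R) (B : set Omega) :
  (forall e : R, 0 < e -> exists S, [/\ measurable S, B `<=` S & (P S <= e%:E)%E]) ->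
  P.-negligible B.
Proof.
move=> H.
have [S HS] := choice (fun n : nat => H n.+1%:R^-1 ltac:(by rewrite invr_gt0)).
exists (\bigcap_n S n); split.
- by apply: bigcapT_measurable => n; case: (HS n).
- apply/eqP; rewrite eq_le measure_ge0 andbT.
  apply/lee_addgt0Pr => e e0; rewrite add0e.
  pose n := Num.truncn e^-1.
  have [mS _ PS] := HS n.
  apply: (@le_trans _ _ (P (S n))).
    apply: le_measure; rewrite ?inE //; last exact: bigcap_inf.
    by apply: bigcapT_measurable => k; case: (HS k).
  apply: le_trans PS _; rewrite lee_fin invf_ple ?posrE //.
  exact/ltW/truncnS_gt.
- by move=> w Bw n _; case: (HS n) => _ + _; apply.
Qed.

(** The density of [W h] is bounded by its peak, which is the constant [k]. *)
Lemma standard_BM_itv {R : realType} d (Omega : measurableType d)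
    (P : probability Omega R) (W : R -> Omega -> R) (h : R) :
  standard_BM P W -> 0 < h ->
  exists2 k : R, 0 < k & forall a l : R, 0 <= l ->
    (P (W h @^-1` [set` `[a, (a + l)%R]]) <= (k * l)%:E)%E.
Proof.
move=> BM h0; have [W0 _ _ _] := BM.
have s0 : Num.sqrt h != 0 by rewrite gt_eqF // sqrtr_gt0.
exists (normal_peak (Num.sqrt h)); first exact: normal_peak_gt0.
move=> a l l0.
have -> : W h @^-1` [set` `[a, (a + l)%R]] =
    (fun w => W h w - W 0 w) @^-1` [set` `[a, (a + l)%R]].
  by apply/seteqP; split => w /=; rewrite W0 subr0.
rewrite (standard_BM_increment BM (lexx 0) h0); last exact: measurable_itv.
rewrite subr0 /normal_prob.
apply: (@le_trans _ _ (\int[lebesgue_measure]_(x in [set` `[a, (a + l)%R]])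
   (normal_peak (Num.sqrt h))%:E)%E).
  apply: ge0_le_integral => //.
  - by move=> x _; rewrite lee_fin normal_pdf_ge0.
  - by apply/measurable_EFinP; apply: measurable_funTS; exact: measurable_normal_pdf.
  - by move=> x _; rewrite lee_fin normal_pdf_ub.
rewrite integral_cst // [X in (_ * X)%E](lebesgue_measure_itv `[a, (a + l)%R]) /= lte_fin.
case: ifPn => _; last by rewrite mule0 lee_fin mulr_ge0 // normal_peak_ge0.
by rewrite -EFinB -EFinM lee_fin addrAC subrr add0r.
Qed.

Lemma standard_BM_point {R : realType} d (Omega : measurableType d)
    (P : probability Omega R) (W : R -> Omega -> R) (m D0 h x : R) :
  standard_BM P W -> 0 < h -> 0 < D0 -> P.-negligible [set w | drifted m D0 W h w = x].
Proof.
move=> BM h0 D00; have [_ _ mW _] := BM.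
have [k k0 Hk] := standard_BM_itv BM h0.
apply: negligible_of_small => e e0.
pose a := (x - m * h) / D0.
exists (W h @^-1` [set` `[a, (a + e / k)]]); split.
- by rewrite -[X in measurable X]setTI; apply: mW => //; exact: measurable_itv.
- move=> w /= Ew; have -> : W h w = a.
    by rewrite /a -Ew /drifted; field; rewrite gt_eqF.
  by rewrite in_itv /= lexx lerDl divr_ge0 // ltW.
- apply: le_trans (Hk _ _ _) _; first by rewrite divr_ge0 // ltW.
  by rewrite lee_fin mulrC divfK // gt_eqF.
Qed.

Lemma probability_indep_setD {R : realType} d (Omega : measurableType d)
    (P : probability Omega R) (A F1 F0 : set Omega) :
  measurable A -> measurable F1 -> measurable F0 -> F0 `<=` F1 ->
  P (F1 `&` A) = (P A * P F1)%E -> P (F0 `&` A) = (P A * P F0)%E ->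
  P ((F1 `\` F0) `&` A) = (P A * P (F1 `\` F0))%E.
Proof.
move=> mA m1 m0 sub e1 e0.
have lt1 S : measurable S -> (P S < +oo)%E.
  by move=> mS; apply: le_lt_trans (probability_le1 _ mS) _; exact: ltry.
have -> : (F1 `\` F0) `&` A = (F1 `&` A) `\` (F0 `&` A).
  apply/seteqP; split => w /=; first by move=> [[? ?] ?]; split => // -[].
  by move=> [[? ?] H]; split => //; split => // ?; apply: H.
rewrite measureD; [|exact: measurableI|exact: measurableI|apply: lt1; exact: measurableI].
rewrite measureD //; last exact: lt1.
have -> : F1 `&` A `&` (F0 `&` A) = F0 `&` A.
  by rewrite setIACA setIid (setIidr sub).
rewrite (setIidr sub).
change (P (F1 `&` A) - P (F0 `&` A) = P A * (P F1 - P F0))%E.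
rewrite e1 e0.
have fin S : measurable S -> P S \is a fin_num by move=> mS; exact: fin_num_measure.
by rewrite muleBr ?fin // fin_num_adde_defr // fin.
Qed.

Lemma argmax_at_level_negligible {R : realType} d (Omega : measurableType d)
    (P : probability Omega R) (W : R -> Omega -> R) (m D0 h q x : R) :
  standard_BM P W -> 0 < D0 -> 0 < h -> h < q ->
  P.-negligible [set w | (exists t, [/\ h <= t, t <= q & drifted m D0 W t w = x]) /\
    forall t, h <= t -> t <= q -> drifted m D0 W t w <= x].
Proof.
move=> BM D00 h0 hq; have [_ _ mW _] := BM.
have [k k0 Hk] := standard_BM_itv BM h0.
set E := drifted m D0 W.
apply: negligible_of_small => e e0.
(* Slice according to the value [y = x - E h] of the maximum of [E - E h]: on [C j], which is
   independent of [W h], one has [(j - 1) dl < y <= j dl], so that [W h] lies in the interval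
   [A j], of probability at most [k dl / D0 = e]. *)
pose dl := e * D0 / k.
have dl0 : 0 < dl by rewrite divr_gt0 // mulr_gt0.
pose F c := dyads_below E h q c.
pose c (j : nat) := j%:R * dl.
pose A j := [set` `[(x - m * h - c j) / D0, ((x - m * h - c j) / D0 + dl / D0)%R]].
pose C j := F (c j) `\` F (c j - dl).
have mF y : measurable (F y) by exact: dyads_below_measurable.
have mC j : measurable (C j) by exact: measurableD.
have mWA j : measurable (W h @^-1` A j).
  by rewrite -[X in measurable X]setTI; apply: mW => //; exact: measurable_itv.
have PD j : P (C j `&` W h @^-1` A j) = (P (W h @^-1` A j) * P (C j))%E.
  apply: probability_indep_setD => //.
  - by apply: dyads_below_mono; rewrite gerBl ltW.
  - by apply: dyads_below_indep => //; exact: measurable_itv.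
  - by apply: dyads_below_indep => //; exact: measurable_itv.
have tC : trivIset setT C.
  apply/trivIsetP => i j _ _; wlog ij : i j / (i < j)%N => [H|] ne.
    by have := ne; rewrite neq_ltn => /orP[]ij; [|rewrite setIC]; apply: H => //; rewrite eq_sym.
  rewrite -subset0 => w [[Fi _] [_ nFj]]; apply: nFj.
  apply: dyads_below_mono Fi; rewrite /c.
  have : i.+1%:R * dl <= j%:R * dl by rewrite ler_pM2r // ler_nat.
  by rewrite -natr1; lra.
exists (\bigcup_j (C j `&` W h @^-1` A j)); split.
- by apply: bigcupT_measurable => j; exact: measurableI.
- move=> w [[t [ht tq Et]] Emax].
  pose y := x - E h w.
  have y0 : 0 <= y by rewrite subr_ge0; apply: Emax => //; exact: ltW.
  have ex : exists j, y <= c j.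
    exists (Num.truncn (y / dl)).+1; rewrite /c -ler_pdivrMr //.
    exact/ltW/truncnS_gt.
  case: (ex_minnP ex) => j yj minj.
  have jy : c j - dl < y.
    case: j yj minj => [|j] yj minj; first by rewrite /c mul0r; lra.
    rewrite ltNge; apply/negP => yc.
    have : y <= c j by move: yc; rewrite /c -natr1; lra.
    by move/minj; rewrite ltnn.
  exists j => //; split; last first.
    have WE : W h w = (x - m * h - y) / D0.
      by rewrite /y /E /drifted; field; rewrite gt_eqF.
    rewrite /A /= WE in_itv /= -mulrDl !ler_pM2r ?invr_gt0 //.
    by apply/andP; split; lra.
  split.
    move=> n _ i i2; apply: le_trans yj; rewrite lerD2r.
    by have /andP[? ?] := dyad_bounds (ltW hq) i2; apply: Emax.
  (* Where the level is attained the increment is [y], which exceeds [c j - dl]; by continuity the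
     same holds at a nearby dyadic point. *)
  move=> HF.
  have cE : continuous (fun t => m * t + D0 * nonneg_path W w t).
    exact: (@affine_continuous R m D0 _ (@nonneg_path_continuous R d Omega P W w BM)).
  have Epath s : 0 <= s -> m * s + D0 * nonneg_path W w s = E s w.
    by move=> s0; rewrite /nonneg_path max_r.
  have t0 : 0 <= t by apply: le_trans ht; exact: ltW.
  have [|d0 d0_gt Hd] := @continuous_near_gt R _ t (E h w + (c j - dl)) cE.
    by rewrite Epath // Et; move: jy; rewrite /y; lra.
  have [n [i [i2 it]]] := dyad_dense hq ht tq d0_gt.
  have /andP[hd _] := dyad_bounds (ltW hq) i2.
  have := Hd _ it; rewrite Epath; last by apply: le_trans hd; exact: ltW.
  by have := HF n I i i2; lra.
(* By independence each slice contributes at most [e] times [P (C j)], and the disjoint [C j] have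
   total probability at most 1. *)
- have mD j : measurable (C j `&` W h @^-1` A j) by exact: measurableI.
  apply: (@le_trans _ _ (\big[+%E/0%E]_(0 <= j <oo) P (C j `&` W h @^-1` A j))%E).
    by apply: measure_sigma_subadditive => //; exact: bigcupT_measurable.
  apply: (@le_trans _ _ (\big[+%E/0%E]_(0 <= j <oo) (e%:E * P (C j)))%E).
    apply: lee_nneseries => [j _ _|j _]; first exact: measure_ge0.
    rewrite PD lee_wpmul2r //.
    apply: le_trans (Hk _ _ _) _; first by rewrite divr_ge0 // ltW.
    by rewrite lee_fin /dl le_eqVlt; apply/orP; left; apply/eqP; field; rewrite !gt_eqF.
  rewrite nneseriesZl; last by move=> j _; exact: measure_ge0.
  rewrite -[leRHS]mule1 lee_wpmul2l //; first by rewrite lee_fin ltW.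
  rewrite -(measure_semi_bigcup P) //; last exact: bigcupT_measurable.
  by apply: probability_le1; exact: bigcupT_measurable.
Qed.

(** A path starting at [0 < x] stays below [x] up to some [h n], so the level is attained after
    [h n]; a countable union over [n] concludes. *)
Lemma max_at_level_negligible {R : realType} d (Omega : measurableType d)
    (P : probability Omega R) (W : R -> Omega -> R) (m D0 q x : R) :
  standard_BM P W -> 0 < D0 -> 0 < q -> 0 < x ->
  P.-negligible [set w | (exists t, [/\ 0 <= t, t <= q & drifted m D0 W t w = x]) /\
    forall t, 0 <= t -> t <= q -> drifted m D0 W t w <= x].
Proof.
move=> BM D00 q0 x0.
pose h (n : nat) := q / n.+2%:R.
have h0 n : 0 < h n by rewrite divr_gt0.
have hq n : h n < q by rewrite ltr_pdivrMr // ltr_pMr // ltr1n.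
apply: (negligibleS _ (negligible_bigcup
  (fun n => argmax_at_level_negligible m x BM D00 (h0 n) (hq n)))).
move=> w [[t [t0 tq Et]] Emax].
have [W0 _ _ _] := BM.
have cE : continuous (fun t => m * t + D0 * nonneg_path W w t).
  exact: (@affine_continuous R m D0 _ (@nonneg_path_continuous R d Omega P W w BM)).
have Epath s : 0 <= s -> m * s + D0 * nonneg_path W w s = drifted m D0 W s w.
  by move=> s0; rewrite /nonneg_path max_r.
have [|e e0 He] := @continuous_near_lt R _ 0 x cE.
  by rewrite Epath // /drifted W0 !mulr0 addr0.
pose n := Num.truncn (q / e).
have hn : h n < e.
  rewrite /h ltr_pdivrMr // mulrC -ltr_pdivrMr //.
  apply: lt_trans (truncnS_gt _) _; by rewrite ltr_nat.
exists n => //; split; last first.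
  by move=> s hs sq; apply: Emax => //; apply: le_trans hs; exact: ltW.
exists t; split => //; rewrite leNgt; apply/negP => th.
have := He t; rewrite subr0 ger0_norm // Epath // Et ltxx => H.
by have : false by apply: H; exact: lt_trans hn.
Qed.

(** The second clause says that no positive level is the exact maximum of [E] over a rational
    horizon; rational horizons keep the exceptional event a countable union. *)
Definition regular_path {R : realType} (b T : R) (E : R -> R) : Prop :=
  (forall k, E T <> k.+1%:R * b) /\
  (forall k i n, ~ ((exists t, [/\ 0 <= t, t <= i.+1%:R / n.+1%:R & E t = k.+1%:R * b]) /\
     forall t, 0 <= t -> t <= i.+1%:R / n.+1%:R -> E t <= k.+1%:R * b)).

Lemma regular_path_ae {R : realType} d (Omega : measurableType d)
    (P : probability Omega R) (W : R -> Omega -> R) (m D0 b T : R) :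
  standard_BM P W -> 0 < D0 -> 0 < b -> 0 < T ->
  {ae P, forall w, regular_path b T (fun t => m * t + D0 * nonneg_path W w t)}.
Proof.
move=> BM D00 b0 T0.
have Epath w s : 0 <= s -> m * s + D0 * nonneg_path W w s = drifted m D0 W s w.
  by move=> s0; rewrite /nonneg_path max_r.
have q0 i n : 0 < i.+1%:R / n.+1%:R :> R by rewrite divr_gt0.
have kb0 k : 0 < k.+1%:R * b by rewrite mulr_gt0.
have N1 := negligible_bigcup (fun k => standard_BM_point m (k.+1%:R * b) BM T0 D00).
have N2 := negligible_bigcup (fun k => negligible_bigcup (fun i => negligible_bigcup
  (fun n => max_at_level_negligible m BM D00 (q0 i n) (kb0 k)))).
apply: (negligibleS _ (negligibleU N1 N2)) => w /= /not_andP[H|H].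
  left; apply: contrapT => nH; apply: H => k Ek; apply: nH.
  by exists k => //=; rewrite -Epath ?ltW.
right; apply: contrapT => nH; apply: H => k i n [[t [t0 tq Et]] Emax].
apply: nH; exists k => //; exists i => //; exists n => //; split.
  by exists t; split; rewrite -?Epath.
by move=> s s0 sq; rewrite -Epath //; exact: Emax.
Qed.

(** Choose a rational [q] between [t] and [t + d]. The level is attained on [[0, q]], hence exceeded
    there, and this can only happen after the first hit. *)
Lemma regular_path_cross {R : realType} (b T : R) (E : R -> R) k t d :
  regular_path b T E -> (0 < k)%N -> first_hit E (k%:R * b) t -> 0 < d ->
  exists u, [/\ t < u, u < t + d & k%:R * b < E u].
Proof.
case: k => // k [_ reg] _ [t0 Et before] d0.
pose n := Num.truncn d^-1.
have nd : n.+1%:R^-1 < d by rewrite invf_plt ?posrE //; exact: truncnS_gt.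
have n0 : 0 < n.+1%:R :> R by [].
pose i := Num.truncn (t * n.+1%:R).
have /andP[it ti] : i%:R <= t * n.+1%:R < i.+1%:R.
  by apply: truncn_itv; rewrite mulr_ge0.
pose q : R := i.+1%:R / n.+1%:R.
have tq : t < q by rewrite ltr_pdivlMr.
have qd : q < t + d.
  apply: (@le_lt_trans _ _ (t + n.+1%:R^-1)); last by rewrite ltrD2l.
  by rewrite /q ler_pdivrMr // mulrDl mulVf ?gt_eqF // -natr1 lerD2r.
have [u [u0 uq Eu]] : exists u, [/\ 0 <= u, u <= q & k.+1%:R * b < E u].
  apply: contrapT => no; apply: (reg k i n); split.
    by exists t; split => //; exact: ltW.
  move=> u u0 uq; rewrite leNgt; apply/negP => Eu; apply: no.
  by exists u.
exists u; split => //; last exact: le_lt_trans qd.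
rewrite ltNge; apply/negP; rewrite le_eqVlt => /predU1P[ut|ut].
  by move: Eu; rewrite ut Et ltxx.
by have := before u u0 ut; rewrite ltNge ltW.
Qed.

(** * Convergence in mean square *)

Import HBNNSimple.

(* For a nonnegative integrand the integral is the supremum over the simple functions below
   it, measurable or not; so the dominated convergence theorem applied to such simple
   functions needs no measurability of the [f n]. *)
Lemma dominated_convergence_lower {R : realType} d (Omega : measurableType d)
    (P : probability Omega R) (f : nat -> Omega -> R) (g : Omega -> \bar R) :
  (forall n w, 0 <= f n w) -> P.-integrable setT g ->
  {ae P, forall w, forall n, ((f n w)%:E <= g w)%E} ->
  {ae P, forall w, f n w @[n --> \oo] --> 0} ->
  forall e, 0 < e -> \forall n \near \oo, (\int[P]_w (f n w)%:E <= e%:E)%E.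
Proof.
move=> f0 ig fg fcvg e e0.
(* [h n] is a simple function below [f n] whose integral exceeds [e] as soon as that of [f n] does,
   and 0 otherwise. Dominated convergence for the [h n] excludes the first case for large [n]. *)
have ex n : exists h : Omega -> R, [/\ measurable_fun setT h, forall w, 0 <= h w,
    forall w, h w <= f n w &
    (e%:E < \int[P]_w (f n w)%:E)%E -> (e%:E < \int[P]_w (h w)%:E)%E].
  have [lt|_] := boolP (e%:E < \int[P]_w (f n w)%:E)%E; last by exists (cst 0); split.
  have lt' := lt; rewrite ge0_integralTE // in lt'; last by move=> w; rewrite lee_fin.
  have /= [_ [h hf <-] eh] := ereal_sup_gt lt'.
  exists h; split => [|w|w|_].
  - exact: measurable_funPT.
  - exact: fun_ge0.
  - by have := hf w; rewrite lee_fin.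
  -
    by rewrite integralT_nnsfun.
have [h Hh] := choice ex.
have mh n : measurable_fun setT (fun w => (h n w)%:E).
  by apply/measurable_EFinP; case: (Hh n).
have h0 n w : 0 <= h n w by case: (Hh n).
have hf n w : h n w <= f n w by case: (Hh n).
have cvgh : {ae P, forall w, [set: Omega] w ->
    (fun n => (h n w)%:E) @ \oo --> cst 0%E w}.
  apply: filterS fcvg => w fw _; apply: cvg_EFin; first by apply: nearW.
  have sq : \forall n \near \oo, (0 : R) <= h n w <= f n w.
    by apply: nearW => n; rewrite h0 hf.
  by apply: (squeeze_cvgr sq _ fw); exact: cvg_cst.
have domh : {ae P, forall w, forall n, [set: Omega] w -> (`|(h n w)%:E| <= g w)%E}.
  apply: filterS fg => w fgw n _; rewrite gee0_abs ?lee_fin //.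
  by apply: le_trans (fgw n); rewrite lee_fin.
have [_ _] := dominated_convergence measurableT mh (measurable_cst _) cvgh ig domh.
rewrite integral_cst // mul0e => H.
have Ne : nbhs (0%E : \bar R) [set x | (x < e%:E)%E].
  by apply: open_nbhs_nbhs; split; [exact: open_ereal_lt_ereal | rewrite /= lte_fin].
have {}H : \forall n \near \oo, (\int[P]_w (h n w)%:E < e%:E)%E by exact: H Ne.
apply: filterS H => n he; rewrite leNgt; apply/negP.
by case: (Hh n) => _ _ _ /[apply]; apply/negP; rewrite -leNgt ltW.
Qed.

Lemma test_function_continuous {R : realType} (phi : R -> R) :
  test_function phi -> continuous phi.
Proof.
move=> [/(_ 0%N) /= dphi _] x.
by apply: differentiable_continuous; apply/derivable1_diffP; exact: dphi.
Qed.

Lemma test_function_bounded {R : realType} (phi : R -> R) :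
  test_function phi -> exists F, forall t, `|phi t| <= F.
Proof.
move=> tphi; have cphi := test_function_continuous tphi.
have [_ [a [c [a0 ac out]]]] := tphi.
have [|u _ Hu] := @EVT_max R (fun t => `|phi t|) a c ac.
  by apply: continuous_subspaceT => t; apply: cvg_norm; exact: cphi.
exists `|phi u| => t.
have [ta|ta] := ltP t a; first by rewrite out ?normr0 //; left.
have [ct|ct] := ltP c t; first by rewrite out ?normr0 //; right.
by apply: Hu; rewrite in_itv /= ta ct.
Qed.

(** Both pairings vanish: [sig] is 0 after [T], [phi] is 0 at time 0, and no positive level is hit
    by time [T]. *)
Lemma degenerate_horizon {R : realType} (m r b D0 D1 eps T : R) (w q sig phi : R -> R) :
  T <= 0 -> 0 < b -> w 0 = 0 -> continuous (fun t : R => w (Num.max 0 t)) ->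
  switched_solution m r b D0 D1 eps T w q sig -> test_function phi ->
  pairing sig phi - limit_pairing (fun t => m * t + D0 * w t) b T phi = 0.
Proof.
move=> T0 b0 w0 cw sol [_ [a [c [a0 _ out]]]].
have -> : pairing sig phi = 0.
  rewrite /pairing (_ : \int[_]_(t in _) _ =
      \int[lebesgue_measure]_(t in `[0, +oo[) (cst 0 t)).
    by rewrite Rintegral_cst // mul0r.
  apply: eq_Rintegral => t; rewrite inE /= in_itv /= andbT => t0.
  have [Tt|tT] := ltP T t; last first.
    by rewrite (out t) ?mulr0 //; left; apply: le_lt_trans a0; exact: le_trans T0.
  by case: sol => s [_ [_ [_ [_ [_ [_ [_ ->]]]]]]] //; rewrite mul0r.
have nh : num_hits (fun t => m * t + D0 * w t) b T = 0%N.
  apply: card_fset_set_initial => -[|k] /=; first by split=> [[]|].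
  split => // -[_]; rewrite leNgt => /negP[].
  apply: (@hitting_time_gt R (fun t => m * t + D0 * w (Num.max 0 t))).
  - exact: affine_continuous.
  - by move=> t t0; rewrite max_r // ltW.
  - by rewrite maxxx w0 !mulr0 addr0 mulr_gt0.
  - move=> t t0 tT; have -> : t = 0 by apply/eqP; rewrite eq_le t0 (le_trans tT T0).
    by rewrite maxxx w0 !mulr0 addr0 mulr_gt0.
by rewrite /limit_pairing nh big_nat_cond big_pred0 ?mulr0 ?subrr // => i; lia.
Qed.

Theorem theorem2 (R : realType) (d : measure_display) (Omega : measurableType d)
  (P : probability Omega R) (W : R -> Omega -> R)
  (m r b D0 D1 T : R)
  (q sig : R -> Omega -> R -> R) (phi : R -> R) :
  0 < m -> 0 < r -> 0 < b -> 0 < D0 -> D0 <= D1 ->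
  standard_BM P W ->
  (forall eps, 0 < eps -> forall w,
     switched_solution m r b D0 D1 eps T (fun t => W t w) (q eps w) (sig eps w)) ->
  test_function phi ->
  (fun eps => (\int[P]_w
     ((pairing (sig eps w) phi
       - limit_pairing (fun t => m * t + D0 * W t w) b T phi) ^+ 2)%:E)%E)
    @ 0^'+ --> 0%E.
Proof.
move=> m0 r0 b0 D00 D01 BM sol tphi.
have D10 : 0 <= D1 by apply: le_trans D01; exact: ltW.
have W0 w : W 0 w = 0 by case: BM.
pose f eps w := (pairing (sig eps w) phi
  - limit_pairing (fun t => m * t + D0 * W t w) b T phi) ^+ 2.
(* Dominated convergence concerns sequences, so the right limit at 0 is tested along
   [u n < 1 / (n + 1)]; a failure of the limit would produce such a sequence. *)
suff Hseq (u : nat -> R) (e : R) : (forall n, 0 < u n) -> (forall n, u n < n.+1%:R^-1) ->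
    0 < e -> \forall n \near \oo, (\int[P]_w (f (u n) w)%:E <= e%:E)%E.
  have small e : 0 < e -> \forall eps \near 0^'+, (\int[P]_w (f eps w)%:E <= e%:E)%E.
    move=> e0; apply: contrapT => no.
    have ex n : exists eps : R, [/\ 0 < eps, eps < n.+1%:R^-1 &
        ~ (\int[P]_w (f eps w)%:E <= e%:E)%E].
      apply: contrapT => no'; apply: no.
      have lt_n : \forall eps \near 0^'+, eps < n.+1%:R^-1 :> R.
        by apply: nbhs_right_lt; rewrite invr_gt0.
      apply: filterS2 lt_n (nbhs_right_gt 0) => eps eps_n eps0.
      by apply: contrapT => big; apply: no'; exists eps.
    have [u Hu] := choice ex.
    have [||N _ HN] := Hseq u e _ _ e0; [by move=> n; case: (Hu n) .. |].
    by case: (Hu N) => _ _; apply; exact: (HN N (leqnn N)).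
  apply/fine_cvgP; split.
    have := small 1 ltr01; apply: filterS => eps le1.
    rewrite ge0_fin_numE; first exact: le_lt_trans le1 (ltry _).
    by apply: integral_ge0 => w _; rewrite lee_fin sqr_ge0.
  apply/cvgrPdist_le => e e0; have := small e e0; apply: filterS => eps le1.
  have ge0 : (0 <= \int[P]_w (f eps w)%:E)%E.
    by apply: integral_ge0 => w _; rewrite lee_fin sqr_ge0.
  rewrite sub0r normrN ger0_norm /=; last exact: fine_ge0.
  by rewrite -lee_fin fineK // ge0_fin_numE //; exact: le_lt_trans le1 (ltry _).
move=> u0 un e0.
have [T0|T0] := leP T 0.
  apply: nearW => n; rewrite (eq_integral (cst 0%E)).
    by rewrite integral_cst // mul0e lee_fin ltW.
  move=> w _; rewrite /f (@degenerate_horizon R m r b D0 D1 (u n) T (W^~ w) (q (u n) w)) //.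
  - by rewrite expr0n.
  - exact: (@nonneg_path_continuous R d Omega P W w BM).
  - exact: sol.
have [F HF] := test_function_bounded tphi.
have cphi := test_function_continuous tphi.
have [C C0 HC] := pairing_limit_bound m0 b0 D00 D10 T0 cphi HF.
pose E w t := m * t + D0 * nonneg_path W w t.
have cw w : continuous (nonneg_path W w) := @nonneg_path_continuous R d Omega P W w BM.
have cE w : continuous (E w) by exact: affine_continuous.
have path_eq w t : 0 <= t -> nonneg_path W w t = W t w.
  by move=> t0; rewrite /nonneg_path max_r.
have E0 w : E w 0 = 0 by rewrite /E path_eq // W0 !mulr0 addr0.
have limE w N tau : hits (E w) b T N tau ->
    limit_pairing (fun t => m * t + D0 * W t w) b T phi =
    b * \sum_(j < N) phi (tau j.+1).
  apply: (limit_pairing_hits _ (cE w) (E0 w) b0) => t t0.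
  by rewrite /E path_eq // ltW.
have c0 n : 0 < r / u n by rewrite divr_gt0.
have ex w n : exists sK : (nat -> R) * nat,
    switching (r / u n) b D1 T (E w) (nonneg_path W w) sK.1 sK.2 /\
    pairing (sig (u n) w) phi = \sum_(j < sK.2./2) r / u n *
      \int[lebesgue_measure]_(x in [set` down_itv T sK.1 j]) phi x.
  have [s [K [sw Hs1 Hs2]]] :=
    switched_solution_switching (ltW T0) (path_eq w) (sol (u n) (u0 n) w).
  by exists (s, K); split => //; exact: pairing_switching cphi sw Hs1 Hs2.
have iV := holder_const_integrable T0 BM.
have finV := integrable_ae measurableT iV.
have regV := @regular_path_ae R d Omega P W m D0 b T BM D00 b0 T0.
(* Domination comes from the integrable Hoelder constant, pointwise convergence from the regularity
   of the path; each holds off a negligible set. *)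
apply: (@dominated_convergence_lower R d Omega P (fun n => f (u n))
  (fun w => C%:E * (1 + holder_const W T w))%E) e0.
- by move=> n w; exact: sqr_ge0.
- apply: integrableZl => //; apply: integrableD => //.
  exact: finite_measure_integrable_cst.
- apply: filterS finV => w /(_ I) fin n.
  have [k [k0 k8 mod]] := holder_const_modulus T0 BM fin.
  have [[s K] /= [sw pE]] := ex w n.
  have [N [tau hh]] := hits_exist (cE w) (E0 w) b0 (ltW T0).
  rewrite /f (limE w N tau hh) pE.
  have -> : (C%:E * (1 + holder_const W T w) = (C * (1 + k ^+ 8))%:E)%E.
    by rewrite k8 EFinM EFinD fineK.
  by rewrite lee_fin; exact: HC k0 mod (c0 n) sw hh.
- apply: filterS2 finV regV => w /(_ I) fin reg.
  have [k [k0 k8 mod]] := holder_const_modulus T0 BM fin.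
  have [N [tau hh]] := hits_exist (cE w) (E0 w) b0 (ltW T0).
  have [sK HsK] := choice (ex w).
  have HO x y : 0 <= x -> x <= T -> 0 <= y -> y <= T ->
      `|nonneg_path W w x - nonneg_path W w y| <= 15 * k.
    move=> x0 xT y0 yT; have := mod 0%N x y x0 xT y0 yT.
    by rewrite !expr0 !divr1; apply; rewrite ler_norml; apply/andP; split; lra.
  have O0 : 0 <= 15 * k by rewrite mulr_ge0.
  have cy : r / u n @[n --> \oo] --> +oo.
    apply/cvgryPge => A; exists (Num.truncn (A / r)) => // n /= An.
    have An1 : A / r < n.+1%:R.
      by apply: lt_le_trans (truncnS_gt _) _; rewrite ler_nat.
    have nu : n.+1%:R < (u n)^-1 by rewrite invf_pgt ?posrE.
    by apply: ltW; rewrite mulrC -ltr_pdivrMr //; exact: lt_trans nu.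
  have conv := @pairing_sum_cvg R b D1 T (15 * k) (E w) (nonneg_path W w) phi N tau
    (fun n => r / u n) (fun n => (sK n).1) (fun n => (sK n).2) (cE w) (E0 w) (cw w) cphi
    b0 D10 O0 (ltW T0) HO _ _ hh c0 cy (fun n => (HsK n).1).
  have {}conv : pairing (sig (u n) w) phi @[n --> \oo] --> b * \sum_(j < N) phi (tau j.+1).
    rewrite (_ : (fun n => pairing _ _) = fun n => \sum_(j < (sK n).2./2) r / u n *
      \int[lebesgue_measure]_(x in [set` down_itv T (sK n).1 j]) phi x).
      apply: conv; first by move=> [|j] // _; case: reg.
      by move=> j t dl j0 fh dl0; exact: regular_path_cross reg j0 fh dl0.
    by apply/funext => n; case: (HsK n).
  rewrite /f (limE w N tau hh).
  set L := b * _ in conv *.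
  suff: (pairing (sig (u n) w) phi - L) ^+ 2 @[n --> \oo] --> (L - L) ^+ 2.
    by rewrite subrr expr0n.
  have cL : pairing (sig (u n) w) phi - L @[n --> \oo] --> L - L.
    by apply: cvgB => //; exact: cvg_cst.
  by rewrite expr2; under eq_cvg do rewrite expr2; exact: cvgM.
Qed.
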